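(* Let $q_1,q_2\in L_{1,1}$ and let $\varphi_j(x,k)$ be the regular solution corresponding to $q_j$, $j=1,2$. Then the pair $\{\ell_1,\ell_2\}$, $\ell_j=-\frac{d^2}{dx^2}+q_j$, has property $C_\varphi$: for every $b$ with $0<b<\infty$, if $h\in L^1(0,b)$ and $$\int_0^b h(x)\varphi_1(x,k)\varphi_2(x,k)\,dx=0\qquad\text{for all } k>0,$$ then $h=0$.
   Context: $\mathbb{R}_+=[0,\infty)$. $L_{1,1}$ is the set of real-valued functions $q$ on $\mathbb{R}_+$ with $\int_0^\infty(1+x)|q(x)|\,dx<\infty$ and $q\in L^2(0,a)$ for every $a<\infty$. The regular solution $\varphi(x,k)$ corresponding to $q$ is the unique solution of $-\varphi''+q(x)\varphi=k^2\varphi$, $x>0$, $\varphi(0,k)=0$, $\varphi'(0,k)=1$ (prime denotes $d/dx$). *)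

(* Defs.v *)
From mathcomp Require Export all_boot all_order all_algebra.
From mathcomp Require Export all_classical all_reals all_analysis.
Export Order.TTheory GRing.Theory Num.Theory.
Export numFieldNormedType.Exports.

#[export] Set Implicit Arguments.
#[export] Unset Strict Implicit.
#[export] Unset Printing Implicit Defensive.

Local Open Scope classical_set_scope.
Local Open Scope ring_scope.

(* Intervals are written [c i, d i] with i : 'I_n; degenerate ones (c i = d i)
   are allowed and contribute nothing to either sum. *)
Definition absolutely_continuous_on (R : realType) (a b : R) (f : R -> R) :
    Prop :=
  forall e : R, 0 < e -> exists2 del : R, 0 < del &
    forall (n : nat) (c d : 'I_n -> R),
      (forall i, [/\ a <= c i, c i <= d i & d i <= b]) ->
      trivIset setT (fun i => `]c i, d i[%classic) ->
      \sum_(i < n) (d i - c i) < del ->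
      \sum_(i < n) `|f (d i) - f (c i)| < e.

(* L_{1,1}; the values of q on the negative half-line play no role. *)
Definition L11 (R : realType) (q : R -> R) : Prop :=
  let mu := @lebesgue_measure R in
  [/\ measurable_fun (`[0, +oo[ : set R) q,
      (\int[mu]_(x in `[0%R, +oo[) ((1 + x) * `|q x|)%:E < +oo)%E
    & forall a : R, 0 < a -> (\int[mu]_(x in `]0%R, a[) (q x ^+ 2)%:E < +oo)%E].

(* phi solves - phi'' + q phi = k^2 phi on x > 0 with phi(0) = 0, phi'(0) = 1.
   As q is only locally integrable, this is understood in the Caratheodory
   sense: phi is C^1 on [0, +oo[, phi' is locally absolutely continuous there,
   and the equation holds almost everywhere. Here dphi is phi' on [0, +oo[, the
   derivative at 0 being the one from the right. *)
Definition is_regular_solution (R : realType) (q : R -> R) (k : R)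
    (phi : R -> R) : Prop :=
  exists dphi : R -> R,
    [/\ (forall x : R, 0 < x -> is_derive x (1 : R) phi (dphi x))
          /\ (fun x : R => (phi x - phi 0) / x) @ 0^'+ --> dphi 0,
        forall a : R, 0 < a -> absolutely_continuous_on 0 a dphi,
        \forall x \ae @lebesgue_measure R, 0 < x ->
          derivable dphi x 1 /\ - (dphi^`())%classic x + q x * phi x = k ^+ 2 * phi x,
        phi 0 = 0
      & dphi 0 = 1].

(* Property C_phi of the pair { - d^2/dx^2 + q1, - d^2/dx^2 + q2 }. The regular
   solution for q_j at k is unique on [0, +oo[, so quantifying over all phi_j
   satisfying its defining conditions amounts to fixing it. *)
Definition property_Cphi (R : realType) (q1 q2 : R -> R) : Prop :=
  let mu := @lebesgue_measure R in
  forall phi1 phi2 : R -> R -> R,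
    (forall k : R, 0 < k -> is_regular_solution q1 k (fun x => phi1 x k)) ->
    (forall k : R, 0 < k -> is_regular_solution q2 k (fun x => phi2 x k)) ->
  forall b : R, 0 < b ->
  forall h : R -> R, mu.-integrable `]0, b[ (fun x => (h x)%:E) ->
    (forall k : R, 0 < k ->
      \int[mu]_(x in `]0, b[) (h x * phi1 x k * phi2 x k) = 0) ->
    \forall x \ae mu, x \in `]0, b[ -> h x = 0.

(* Main.v *)
Require Import Defs.
From mathcomp Require Import measurable_realfun ring lra.
Local Open Scope classical_set_scope.
Local Open Scope ring_scope.

(**
Write [s(x,k) = sin(kx)/k]. Instead of constructing a transformation kernel, one
shows that there is a constant [M], depending only on [q1], [q2] and [b], such
that whenever [g0 = sum_i a_i s(.,k_i)^2] is nonnegative and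
[g = sum_i a_i phi1(.,k_i) phi2(.,k_i)],
  [|g(x) - g0(x)| <= M * int_0^x g0]  for [0 <= x <= b].
Since [h] is orthogonal to [g], this gives
  [|int_0^b h g0| <= M * int_0^b |h(x)| (int_0^x g0) dx].
Polynomials without constant term in [sin^2(pi x / (2b))] are admissible, and
they can be made to converge boundedly to the indicator of any [(c,d)]; hence
[|int_c^d h| <= M (d - c) int_c^b |h|]. By Lebesgue differentiation
[|h(x)| <= M int_a^b |h|] for almost every [x] in [(a,b)], so [h] vanishes near
[b], and one proceeds leftwards in steps of fixed length.

The kernel-free bound comes from a wave equation: for weights [b_i] the function
[D(t,y) = sum_i b_i (phi(t,k_i) - s(t,k_i)) cos(k_i y)] satisfies a Duhamel
formula whose source is controlled by [D] itself and by [sum_i b_i s(.,k_i)] on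
the domain of dependence [|y| <= x - t].
*)

(** The obstacle is uniformity: the polynomials approximating an indicator have ever more terms and
    larger weights, so no estimate may see the [k_i], the weights or their number. Pairing with
    [cos(k_i y)] achieves this: [- k_i^2] becomes the second derivative in [y], and all the
    equations merge into the single equation [D_tt - D_yy = q(t) sum_i b_i phi(t,k_i) cos(k_i y)],
    free of [k_i]. The weights must be arbitrary because a product is treated one factor at a time,
    the other factor being frozen at a point and absorbed in the weights. Squares and nonnegativity
    enter through [s(y) s(t) = s((y+t)/2)^2 - s((y-t)/2)^2]: a sum of products is a difference of
    two values of [g0], hence at most the sum of these values, and integrating that sum gives a
    multiple of [int_0^x g0]. Local square integrability of the potentials serves to make the
    Duhamel operator a contraction in an exponentially weighted norm. *)

(** * Real induction and calculus of absolutely continuous functions *)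

(** Apply the step at the supremum [t] of the points where [Q] holds. It goes from some [u <= t] to
    [v >= t], because [Q t] itself is not known beforehand; unless [t = b], it reaches beyond the
    supremum. *)
Lemma real_induction (R : realType) (a b : R) (Q : R -> Prop) : a <= b ->
  Q a ->
  (forall t, a <= t <= b -> exists2 r : R, 0 < r &
     forall u v, a <= u -> t - r < u -> u <= t -> t <= v -> v < t + r ->
       v <= b -> Q u -> Q v) ->
  Q b.
Proof.
move=> ab Qa step.
pose S := [set x | [/\ a <= x, x <= b & Q x]].
have Sa : S a by split.
have hS : has_sup S by split; [exists a|exists b => x []].
have aS : a <= sup S by apply: ub_le_sup => //; exact: hS.2.
have Sb : sup S <= b by apply: ge_sup; [exists a|move=> x []].
have [r r0 Hr] := step (sup S) ltac:(by rewrite aS Sb).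
have [u Su ru] := sup_adherent r0 hS.
case: (Su) => au ub Qu.
have uS : u <= sup S by apply: ub_le_sup => //; exact: hS.2.
have H v : sup S <= v -> v < sup S + r -> v <= b -> Q v.
  by move=> h1 h2 h3; apply: (Hr u v).
have [bS|Sb'] := leP b (sup S).
  apply: H => //.
  by rewrite (le_lt_trans bS)// ltrDl.
pose v := Num.min b (sup S + r / 2).
have Sv : sup S < v by rewrite lt_min Sb' ltrDl divr_gt0.
suff : v <= sup S by rewrite leNgt Sv.
apply: ub_le_sup; first exact: hS.2.
split; first by rewrite (le_trans aS)// ltW.
  by rewrite ge_min lexx.
apply: H; first exact: ltW.
  by rewrite gt_min ltrD2l gtr_pMr// invf_lt1// ltr1n orbT.
by rewrite ge_min lexx.
Qed.

Lemma negligible_open_cover (R : realType) (A : set R) (e : R) :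
  (@lebesgue_measure R).-negligible A -> 0 < e ->
  exists U : set R, [/\ open U, A `<=` U & (lebesgue_measure U < e%:E)%E].
Proof.
move=> [B [mB B0 AB]] e0.
have B0' : @lebesgue_measure R B = 0%E := B0.
have Boo : (@lebesgue_measure R B < +oo)%E by rewrite B0'.
have [U [oU BU Ue]] := @lebesgue_regularity_outer R B e mB Boo e0.
exists U; split => //; first exact: subset_trans BU.
rewrite -(setDUK BU) measureU//.
- change (@lebesgue_measure R B + @lebesgue_measure R (U `\` B) < e%:E)%E.
  by rewrite B0' add0e.
- by apply: measurableD => //; exact: open_measurable.
- by rewrite setDE setICA setICr setI0.
Qed.

Lemma lebesgue_measure_bigU_oo (R : realType) (n : nat) (c d : 'I_n -> R) :
  (forall i, c i <= d i) -> trivIset setT (fun i => `]c i, d i[%classic) ->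
  lebesgue_measure (\big[setU/set0]_(i < n) `]c i, d i[%classic) =
    (\sum_(i < n) (d i - c i))%:E.
Proof.
move=> cd tcd; rewrite measure_semi_additive_ord//; last exact: bigsetU_measurable.
rewrite -sumEFin; apply: eq_bigr => i _.
apply: (etrans (lebesgue_measure_itv _)) => /=; rewrite lte_fin.
case: ltP => // dc.
by rewrite (@le_anti _ _ (c i) (d i)) ?subrr// dc cd.
Qed.

(* Cousin-type argument: cover the exceptional null set by a small open set and
   march from [a] to [b], paying [e * length] at good points and using absolute
   continuity on the steps inside the open set. *)
Lemma absolutely_continuous_derive0 (R : realType) (a b : R) (f : R -> R) :
  a <= b -> absolutely_continuous_on a b f ->
  (\forall x \ae @lebesgue_measure R, a < x < b -> is_derive x (1 : R) f 0) ->
  f b = f a.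
Proof.
move=> ab acf f'0.
suff H e : 0 < e -> `|f b - f a| <= e * (b - a) + e.
  apply/eqP; rewrite -subr_eq0 -normr_le0; apply/ler_addgt0Pr => e e0.
  rewrite add0r.
  have d0 : 0 < b - a + 1 by rewrite ltr_wpDl// subr_ge0.
  apply: (le_trans (H (e / (b - a + 1)) _)); first by rewrite divr_gt0.
  by rewrite -[X in _ + X]mulr1 -mulrDr divfK// gt_eqF.
move=> e0.
have [del del0 Hdel] := acf e e0.
(* The derivative is known only inside [(a, b)], so the two endpoints are put among the exceptional
   points. *)
have [U [oU AU Udel]] : exists U : set R, [/\ open U,
    ~` [set x | a < x < b -> is_derive x (1 : R) f 0] `|` [set a; b] `<=` U
    & (lebesgue_measure U < del%:E)%E].
  apply: negligible_open_cover => //.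
  apply: negligibleU => //.
  by apply: negligibleU; apply/negligibleP => //; exact: lebesgue_measure_set1.
(* The intervals collected on the way are disjoint and lie in [U], so their total length stays below
   [del] and the last sum is less than [e]. *)
pose Q x := exists (n : nat) (c d : 'I_n -> R),
  [/\ forall i, [/\ a <= c i, c i <= d i & d i <= x],
     trivIset setT (fun i => `]c i, d i[%classic),
     forall i, `]c i, d i[ `<=` U &
     `|f x - f a| <= e * (x - a) + \sum_(i < n) `|f (d i) - f (c i)|].
have Qb : Q b.
  apply: (real_induction ab).
    exists 0%N, (fun=> 0), (fun=> 0); split; try by case.
    by rewrite !subrr normr0 mulr0 big_ord0 addr0.
  move=> t /andP[at_ tb].
  have [Ut|NUt] := pselect (U t).
    have /nbhs_ballP[r /= r0 rU] : nbhs t U by apply: open_nbhs_nbhs.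
    exists r => // u v au tu ut tv vt vb [n [c [d [H1 H2 H3 H4]]]].
    have uv : u <= v by exact: le_trans tv.
    pose c' (i : 'I_(n + 1)) := match fintype.split i with inl j => c j | inr _ => u end.
    pose d' (i : 'I_(n + 1)) := match fintype.split i with inl j => d j | inr _ => v end.
    exists (n + 1)%N, c', d'; split.
    - move=> i; rewrite /c' /d'; case: (fintype.split i) => [j|_]; last by split.
      by have [? ? ?] := H1 j; split => //; exact: le_trans uv.
    - apply/trivIsetP => i j _ _.
      rewrite /c' /d' -{1}(fintype.splitK i) -{1}(fintype.splitK j).
      case: (fintype.split i) (fintype.split j) => [i'|i'] [j'|j'] /=.
      + rewrite (inj_eq (@lshift_inj _ _)).
        by move/trivIsetP : H2 => /(_ i' j' Logic.I Logic.I).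
      + move=> _; have [_ _ du] := H1 i'.
        apply/seteqP; split => x //= []; rewrite !in_itv/=.
        move=> /andP[_ xd] /andP[ux _].
        by have := lt_trans ux (lt_le_trans xd du); rewrite ltxx.
      + move=> _; have [_ _ du] := H1 j'.
        apply/seteqP; split => x //= []; rewrite !in_itv/=.
        move=> /andP[ux _] /andP[_ xd].
        by have := lt_trans ux (lt_le_trans xd du); rewrite ltxx.
      + by rewrite (ord1 i') (ord1 j') eqxx.
    - move=> i; rewrite /c' /d'; case: (fintype.split i) => [j|_] //.
      move=> x /=; rewrite in_itv/= => /andP[ux xv]; apply: rU.
      rewrite /ball/= ltr_distlC.
      by rewrite (lt_trans tu ux) (lt_trans xv vt).
    - rewrite big_split_ord/= big_ord1.
      rewrite (_ : \sum_(i < n) _ = \sum_(i < n) `|f (d i) - f (c i)|); last first.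
        apply: eq_bigr => i _; rewrite /c' /d'.
        by rewrite (fintype.unsplitK (inl i) : fintype.split (lshift 1 i) = _).
      rewrite /c' /d' (fintype.unsplitK (inr ord0) : fintype.split (rshift n ord0) = _) addrA.
      rewrite -[f v - f a](subrKA (f u)) (le_trans (ler_normD _ _))// [leRHS]addrC lerD2l.
      by rewrite (le_trans H4)// lerD2r ler_wpM2l ?lerD2r// ltW.
  have fd : is_derive t (1 : R) f 0.
    apply: contrapT => nd; apply: (NUt); apply: (AU).
    by left => /= H; apply: nd; apply: H; rewrite !lt_neqAle at_ tb !andbT;
      apply/andP; split; apply/eqP => E; subst t; apply: NUt; apply: AU; right;
      [left|right].
  have [r r0 Hr] : exists2 r : R, 0 < r & forall h, `|h| < r ->
      `|f (t + h) - f t| <= e * `|h|.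
    have fd' : derivable f t 1 by [].
    have D0 : 'D_1 f t = 0 by exact: derive_val.
    have := fd'; rewrite /derivable => /cvg_ex[l fl].
    have l0 : l = 0 by rewrite -D0; apply/esym/cvg_lim.
    move: fl; rewrite l0 => /cvgrPdist_le /(_ e e0).
    rewrite /dnbhs/= near_withinE => /nbhs_ballP[r /= r0 Hr].
    exists r => // h hr; have [->|h0] := eqVneq h 0.
      by rewrite addr0 subrr !normr0 mulr0.
    have := Hr h; rewrite /ball/= sub0r normrN => /(_ hr h0).
    rewrite sub0r normrN normrM normfV mulrC ler_pdivrMr ?normr_gt0//.
    have -> : h%:A + t = t + h by rewrite addrC [X in _ + X]mulr1.
    exact.
  exists r => // u v au tu ut tv vt vb [n [c [d [H1 H2 H3 H4]]]].
  exists n, c, d; split => //.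
    by move=> i; have [? ? ?] := H1 i; split => //; apply: le_trans (le_trans ut tv).
  rewrite -[f v - f a](subrKA (f u)) (le_trans (ler_normD _ _))//.
  have -> : e * (v - a) = e * (v - u) + e * (u - a) by rewrite -mulrDr subrKA.
  rewrite -addrA lerD//.
  rewrite -[f v - f u](subrKA (f t)) (le_trans (ler_normD _ _))//.
  have -> : e * (v - u) = e * (v - t) + e * (t - u) by rewrite -mulrDr subrKA.
  rewrite lerD//.
    have := Hr (v - t); rewrite subrKC ger0_norm ?subr_ge0//; apply.
    by rewrite ltrBlDl.
  have := Hr (u - t); rewrite subrKC distrC (distrC (f u)) ger0_norm ?subr_ge0//; apply.
  by rewrite ltrBlDr -ltrBlDl.
have [n [c [d [H1 H2 H3 /le_trans]]]] := Qb; apply.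
rewrite lerD2l ltW//; apply: Hdel => //.
rewrite -lte_fin -lebesgue_measure_bigU_oo//; last by move=> i; case: (H1 i).
apply: le_lt_trans Udel.
apply: le_measure; rewrite ?inE//; first exact: bigsetU_measurable.
  exact: open_measurable.
by apply: (big_ind (fun A : set R => A `<=` U)) => // V W VU WU; rewrite subUset.
Qed.

(** The difference of [F] and the indefinite integral of [G] is absolutely continuous, by absolute
    continuity of the integral, and has derivative 0 almost everywhere by Lebesgue differentiation;
    hence it is constant. *)
Lemma absolutely_continuous_FTC2 (R : realType) (a b : R) (F G : R -> R) :
  a <= b -> absolutely_continuous_on a b F ->
  (@lebesgue_measure R).-integrable `[a, b] (EFin \o G) ->
  (\forall x \ae @lebesgue_measure R, a < x < b -> is_derive x (1 : R) F (G x)) ->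
  \int[@lebesgue_measure R]_(x in `[a, b]) G x = F b - F a.
Proof.
move=> ab acF iG F'G.
set mu := @lebesgue_measure R.
have aeF : Filter (almost_everywhere mu) := ae_filter_ringOfSetsType mu.
pose g := G \_ `[a, b].
have ig : mu.-integrable setT (EFin \o g).
  rewrite /g -restrict_EFin -integrable_mkcond//; exact: measurable_itv.
have ig' (i : interval R) : mu.-integrable [set` i] (EFin \o g).
  by apply: integrableS ig => //; exact: measurable_itv.
pose I x := \int[mu]_(t in `[a, x]) g t.
have I'g : \forall x \ae mu, a < x -> is_derive x (1 : R) I (g x).
  have := @FTC1 R g (BLeft a) (fun y => ig' _)
     (integrable_locally (measurable_itv _) iG).
  apply: filterS => x Ix ax.
  have [|dI <-] := Ix; first by rewrite /= lte_fin.
  by rewrite derive1E; exact: DeriveDef.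
have IB c d : a <= c -> c <= d -> I d - I c = \int[mu]_(t in `]c, d]) g t.
  by move=> ac cd; rewrite /I Rintegral_itvB// bnd_simp.
pose N := F - I.
have acN : absolutely_continuous_on a b N.
  move=> e e0.
  have e20 : 0 < e / 2 by rewrite divr_gt0.
  have [d1 d10 H1] := acF _ e20.
  have [d2 [d20 H2]] := integral_normr_continuous ig e20.
  exists (Num.min d1 d2); first by rewrite lt_min d10.
  move=> n c d cd tcd; rewrite lt_min => /andP[s1 s2].
  have {}H1 := H1 n c d cd tcd s1.
  have mcd : measurable (\big[setU/set0]_(i < n) (`]c i, d i[%classic : set R)).
    exact: bigsetU_measurable.
  apply: (@le_lt_trans _ _ (\sum_(i < n) `|F (d i) - F (c i)| +
     \int[mu]_(x in \big[setU/set0]_(i < n) `]c i, d i[%classic) `|g x|)); last first.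
    rewrite [ltRHS]splitr ltrD//; apply: H2 => //.
    apply: (@le_lt_trans _ _ (\sum_(i < n) (d i - c i))%:E); last by rewrite lte_fin.
    by rewrite -lebesgue_measure_bigU_oo// => i; case: (cd i).
  have -> : \int[mu]_(x in \big[setU/set0]_(i < n) `]c i, d i[%classic) `|g x| =
      \sum_(i < n) \int[mu]_(x in `]c i, d i[) `|g x|.
    rewrite /Rintegral integral_bigsetU_EFin//=.
    - rewrite (eq_bigr (fun i => (\int[mu]_(x in `]c i, d i[) `|g x|)%:E)) ?sumEFin//.
      move=> i _; rewrite /Rintegral fineK//.
      by apply: integrable_fin_num => //; apply: integrable_norm; exact: ig'.
    - exact: index_enum_uniq.
    - by apply: sub_trivIset tcd.
    - apply/measurable_EFinP/measurableT_comp => //.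
      apply: measurable_funS (@subsetT _ _) _ => //.
      by apply/measurable_EFinP; case/integrableP : ig.
  rewrite -big_split/=; apply: ler_sum => i _.
  have [ac cd' db] := cd i.
  rewrite /N !fctE opprD opprK addrACA (le_trans (ler_normD _ _))// lerD2l.
  rewrite [_ + I _]addrC distrC IB//.
  apply: (le_trans (le_normr_Rintegral _ _)) => //.
  by rewrite Rintegral_itv_bndo_bndc//; apply: integrable_norm; exact: ig'.
have N0 : N b = N a.
  apply: absolutely_continuous_derive0 => //.
  apply: filterS2 F'G I'g => x Fx Ix /andP[ax xb].
  rewrite -(subrr (G x)); apply: is_deriveB; first by apply: Fx; rewrite ax.
  have := Ix ax; rewrite /g patchE mem_set//=.
  by rewrite in_itv/= !ltW.
have Ia : I a = 0 by rewrite /I set_itv1 Rintegral_set1.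
have -> : \int[mu]_(x in `[a, b]) G x = I b.
  by apply: eq_Rintegral => x xab; rewrite /g patchE xab.
move: N0; rewrite /N !fctE Ia subr0 => <-.
by rewrite opprB addrC subrK.
Qed.

(** Mean value theorem for [g + f] and [g - f], whose derivatives are nonnegative. The variable
    majorant [dg] spares integrating [df]. *)
Lemma ler_norm_increment (R : realType) (f g df dg : R -> R) (a b : R) :
  a <= b ->
  (forall x, x \in `]a, b[ -> is_derive x (1 : R) f (df x)) ->
  (forall x, x \in `]a, b[ -> is_derive x (1 : R) g (dg x)) ->
  {within `[a, b], continuous f} -> {within `[a, b], continuous g} ->
  (forall x, x \in `]a, b[ -> `|df x| <= dg x) ->
  `|f b - f a| <= g b - g a.
Proof.
rewrite le_eqVlt => /predU1P[->|ab]; first by rewrite !subrr normr0.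
move=> f' g' cf cg dfg.
rewrite ler_norml; apply/andP; split.
  have [||x xab] := @MVT _ (g + f) (dg + df) _ _ ab.
  - by move=> x xab; apply: is_deriveD; [exact: g'|exact: f'].
  - by move=> x; apply: cvgD; [exact: cg|exact: cf].
  move=> E.
  have := dfg x xab; rewrite ler_norml => /andP[h _].
  have : 0 <= (dg x + df x) * (b - a) by rewrite mulr_ge0//; lra.
  move: E; rewrite !fctE; lra.
have [||x xab] := @MVT _ (g - f) (dg - df) _ _ ab.
- by move=> x xab; apply: is_deriveB; [exact: g'|exact: f'].
- by move=> x; apply: cvgB; [exact: cg|exact: cf].
move=> E.
have := dfg x xab; rewrite ler_norml => /andP[_ h].
have : 0 <= (dg x - df x) * (b - a) by rewrite mulr_ge0//; lra.
move: E; rewrite !fctE; lra.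
Qed.

Lemma lipschitz_derive (R : realType) (f df : R -> R) (L a b : R) : a <= b ->
  (forall x, x \in `]a, b[ -> is_derive x (1 : R) f (df x)) ->
  {within `[a, b], continuous f} ->
  (forall x, x \in `]a, b[ -> `|df x| <= L) ->
  `|f b - f a| <= L * (b - a).
Proof.
move=> ab f' cf dfL; rewrite mulrBr.
apply: (@ler_norm_increment _ f (fun x => L * x) df (fun=> L)) => //.
  move=> x _; rewrite -[X in is_derive _ _ _ X]mulr1.
  exact: (@is_deriveZ _ _ _ id L x 1 1).
by apply: continuous_subspaceT => x; exact: mulrl_continuous.
Qed.

(** Real induction: across a step shorter than [del] the function changes by less than 1. *)
Lemma absolutely_continuous_bounded (R : realType) (a b : R) (f : R -> R) :
  a <= b -> absolutely_continuous_on a b f ->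
  exists M, forall x, a <= x <= b -> `|f x| <= M.
Proof.
move=> ab /(_ 1 ltr01)[del del0 H].
apply: (@real_induction _ a b (fun y => exists M, forall x, a <= x <= y -> `|f x| <= M)) => //.
  exists `|f a| => x; rewrite -eq_le => /eqP <-//.
move=> t /andP[ta tb]; exists (del / 2); first by rewrite divr_gt0.
move=> u v au tu ut tv vt vb [M HM].
exists (M + 1) => x /andP[ax xv].
have [xu|ux] := leP x u.
  by rewrite (le_trans (HM x _)) ?ax// lerDl.
have -> : f x = f u + (f x - f u) by rewrite addrC subrK.
rewrite (le_trans (ler_normD _ _))// lerD//; first by rewrite HM// au lexx.
have := H 1%N (fun=> u) (fun=> x); rewrite !big_ord1 => H1; apply/ltW/H1.
- by move=> _; split => //; [exact: ltW|exact: le_trans vb].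
- by apply/trivIsetP => i j _ _; rewrite (ord1 i) (ord1 j) eqxx.
- lra.
Qed.

(** Meant for [f = phi'] and a combination [g] of [phi'] and [phi] with Lipschitz coefficients. *)
Lemma absolutely_continuous_le (R : realType) (a b A L : R) (f g : R -> R) :
  0 <= A -> 0 <= L -> absolutely_continuous_on a b f ->
  (forall c d, a <= c -> c <= d -> d <= b ->
    `|g d - g c| <= A * `|f d - f c| + L * (d - c)) ->
  absolutely_continuous_on a b g.
Proof.
move=> A0 L0 acf gf e e0.
have A1 : 0 < A + 1 by rewrite ltr_wpDl.
have L1 : 0 < L + 1 by rewrite ltr_wpDl.
have eA : 0 < e / 2 / (A + 1) by rewrite !divr_gt0.
have eL : 0 < e / 2 / (L + 1) by rewrite !divr_gt0.
have [del del0 H] := acf _ eA.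
exists (Num.min del (e / 2 / (L + 1))); first by rewrite lt_min del0.
move=> n c d cd tcd; rewrite lt_min => /andP[s1 s2].
have {}H := H n c d cd tcd s1.
apply: (@le_lt_trans _ _ (A * (\sum_(i < n) `|f (d i) - f (c i)|) +
   L * \sum_(i < n) (d i - c i))).
  rewrite !mulr_sumr -big_split/=; apply: ler_sum => i _.
  by have [? ? ?] := cd i; exact: gf.
have le1 (B t : R) : 0 <= B -> 0 < B + 1 -> t < e / 2 / (B + 1) -> 0 <= t ->
    B * t < e / 2.
  move=> B0 B1 + t0; rewrite ltr_pdivlMr// mulrC; apply: le_lt_trans.
  by rewrite ler_wpM2r// lerDl.
rewrite [ltRHS]splitr ltrD//; apply: le1 => //; apply: sumr_ge0 => // i _.
by have [_ ? _] := cd i; rewrite subr_ge0.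
Qed.

(** * Integrability of the potential and its exponentially weighted integral *)

Lemma integrable_L11 (R : realType) (q : R -> R) (b : R) : L11 q ->
  (@lebesgue_measure R).-integrable `[0, b] (EFin \o q).
Proof.
move=> [mq iq _].
have : (@lebesgue_measure R).-integrable `[0, +oo[ (EFin \o q).
  apply/integrableP; split.
    exact/measurable_EFinP.
  apply: le_lt_trans iq; apply: ge0_le_integral => //.
  - apply/measurable_EFinP.
    exact: measurableT_comp.
  - apply/measurable_EFinP.
    apply: measurable_funM.
      exact: measurable_funD.
    exact: measurableT_comp.
  - move=> x; rewrite /= in_itv/= andbT => x0; rewrite lee_fin.
    by rewrite ler_peMl// lerDl.
apply: integrableS => //.
by apply: subset_itvl; rewrite bnd_simp.
Qed.

Lemma integrable_L11_sqr (R : realType) (q : R -> R) (b : R) : 0 < b -> L11 q ->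
  (@lebesgue_measure R).-integrable `[0, b] (EFin \o (fun x => q x ^+ 2)).
Proof.
(* [L11] controls [q ^+ 2] on open intervals; taking [b + 1] keeps the endpoint [b], and the point 0
   is added as a null set. *)
move=> b0 [mq _ /(_ (b + 1))]; rewrite ltr_pwDr ?ltr01 ?ltW// => /(_ isT) iq.
have mq2 (D : set R) : measurable D -> D `<=` `[0, +oo[ ->
    measurable_fun D (EFin \o (fun x => q x ^+ 2)).
  move=> mD D0; apply/measurable_EFinP.
  apply: measurable_funX.
  by apply: measurable_funS D0 mq.
have i1 : (@lebesgue_measure R).-integrable `]0, (b + 1)[
    (EFin \o (fun x => q x ^+ 2)).
  apply/integrableP; split.
    apply: mq2 => // x; rewrite /= !in_itv/= andbT => /andP[/ltW//].
  apply: le_lt_trans iq; rewrite le_eqVlt; apply/orP; left; apply/eqP.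
  by apply: eq_integral => x _; rewrite /= ger0_norm// sqr_ge0.
have : (@lebesgue_measure R).-integrable `]0, b] (EFin \o (fun x => q x ^+ 2)).
  apply: integrableS i1 => //.
  by apply: subset_itvl; rewrite bnd_simp ltrDl.
move=> /integrableP[_ i2]; apply/integrableP; split.
  by apply: mq2 => //; apply: subset_itvl; rewrite bnd_simp.
apply: le_lt_trans i2; rewrite le_eqVlt; apply/orP; left; apply/eqP.
rewrite integral_itv_obnd_cbnd//.
apply: (@measurableT_comp _ _ _ _ _ _ (@abse R)) => //; apply: mq2 => //.
by move=> x; rewrite /= !in_itv/= andbT => /andP[/ltW].
Qed.

Lemma integrable_mul_continuous (R : realType) (a b : R) (f g : R -> R) :
  a <= b -> (@lebesgue_measure R).-integrable `[a, b] (EFin \o f) ->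
  {within `[a, b], continuous g} ->
  (@lebesgue_measure R).-integrable `[a, b] (EFin \o (fun x => f x * g x)).
Proof.
move=> ab intf cg.
have -> : EFin \o (fun x => f x * g x) = ((EFin \o g) \* (EFin \o f))%E.
  by apply/funext => r /=; rewrite -EFinM mulrC.
apply: integrableMr => //.
  by apply: subspace_continuous_measurable_fun => //.
have cng : {within `[a, b], continuous (fun x => `|g x|)}.
  by move=> x; apply: cvg_norm; exact: cg.
have [c _ Hc] := EVT_max ab cng.
exists `|g c|; split; first exact: num_real.
by move=> M cM x /= xab; rewrite (le_trans _ (ltW cM))//; apply: Hc.
Qed.

Lemma integrable_continuous_itv (R : realType) (a b : R) (g : R -> R) :
  {within `[a, b], continuous g} ->
  (@lebesgue_measure R).-integrable `[a, b] (EFin \o g).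
Proof.
by move=> cg; apply: continuous_compact_integrable => //; exact: segment_compact.
Qed.

Lemma Rintegral_derive (R : realType) (a b : R) (F f : R -> R) : a <= b ->
  continuous f -> (forall x, is_derive x (1 : R) F (f x)) ->
  \int[@lebesgue_measure R]_(x in `[a, b]) f x = F b - F a.
Proof.
rewrite le_eqVlt => /predU1P[->|ab] cf F'.
  by rewrite set_itv1 Rintegral_set1 subrr.
have cF : continuous F.
  move=> x; apply/differentiable_continuous/derivable1_diffP.
  by have := F' x.
rewrite /Rintegral (@continuous_FTC2 _ _ F)//.
- exact: continuous_subspaceT.
- split => [x _||]; first by have := F' x.
  + by apply: cvg_at_right_filter; exact: cF.
  + by apply: cvg_at_left_filter; exact: cF.
- by move=> x _; rewrite derive1E; have F'x := F' x; rewrite derive_val.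
Qed.

Lemma integrableZl_EFin d (T : measurableType d) (R : realType)
    (mu : {measure set T -> \bar R}) (D : set T) (k : R) (f : T -> R) :
  measurable D -> mu.-integrable D (EFin \o f) ->
  mu.-integrable D (EFin \o (fun x => k * f x)).
Proof. by move=> mD intf; exact: (integrableZl mD k intf). Qed.

Lemma integrableD_EFin d (T : measurableType d) (R : realType)
    (mu : {measure set T -> \bar R}) (D : set T) (f g : T -> R) :
  measurable D -> mu.-integrable D (EFin \o f) -> mu.-integrable D (EFin \o g) ->
  mu.-integrable D (EFin \o (fun x => f x + g x)).
Proof.
by move=> mD intf intg; exact: (integrableD mD intf intg).
Qed.

(** With the weight [expR (- c * t)], a Volterra operator with density [q] gets norm at most [eta].
    The proof splits [|q| <= q^2 / (2 N) + N / 2]; the first part uses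
    [expR (c * r) <= expR (c * t)], the second the primitive [expR (c * r) / c]. *)
Lemma integral_norm_expR_le (R : realType) (q : R -> R) (b eta : R) :
  0 < b -> L11 q -> 0 < eta -> exists2 c : R, 0 < c & forall t, 0 <= t <= b ->
  \int[@lebesgue_measure R]_(r in `[0, t]) (`|q r| * expR (c * r)) <=
    eta * expR (c * t).
Proof.
move=> b0 q11 eta0.
set mu := @lebesgue_measure R.
have iq2 := integrable_L11_sqr b0 q11.
pose B := \int[mu]_(r in `[0, b]) (q r ^+ 2).
have B0 : 0 <= B by apply: Rintegral_ge0 => x _; rewrite sqr_ge0.
(* [B <= eta * N] and [c = N / eta] make each of the two parts at most [eta / 2 * expR (c * t)]; the
   summand 1 keeps [N] positive when [B = 0]. *)
pose N := B / eta + 1.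
have N0 : 0 < N by rewrite ltr_wpDl// divr_ge0// ltW.
pose c := N / eta.
have c0 : 0 < c by rewrite divr_gt0.
exists c => // t /andP[]; rewrite le_eqVlt => /predU1P[<- _|t0 tb].
  by rewrite set_itv1 Rintegral_set1 mulr_ge0 ?expR_ge0// ltW.
have cexp : continuous (fun r : R => expR (c * r)).
  by move=> r; apply: continuous_comp; [exact: mulrl_continuous|exact: continuous_expR].
have iexp : mu.-integrable `[0, t] (EFin \o (fun r => expR (c * r))).
  apply: continuous_compact_integrable; first exact: segment_compact.
  exact: continuous_subspaceT.
have iq2t : mu.-integrable `[0, t] (EFin \o (fun x => q x ^+ 2)).
  apply: integrableS iq2 => //.
  by apply: subset_itvl; rewrite bnd_simp.
have iqt := integrable_L11 t q11.
have i1 : mu.-integrable `[0, t] (EFin \o (fun r => `|q r| * expR (c * r))).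
  apply: (integrable_mul_continuous (ltW t0) (integrable_norm iqt)).
  exact: continuous_subspaceT.
have dexp (r : R) : is_derive r (1 : R) (fun r => expR (c * r) / c) (expR (c * r)).
  have d : is_derive r (1 : R) (fun r => c * r) c.
    rewrite -[X in is_derive _ _ _ X]mulr1.
    exact: (@is_deriveZ _ _ _ id c r 1 1).
  have -> : (fun r0 => expR (c * r0) / c) = c^-1 *: (expR \o (fun r => c * r)).
    by apply/funext => y; rewrite !fctE/= mulrC.
  have := is_deriveZ c^-1 (is_derive1_comp (is_derive_expR (c * r)) d).
  by rewrite [X in is_derive _ _ _ X]mulrC mulfK// gt_eqF.
have iexpE : \int[mu]_(r in `[0, t]) expR (c * r) <= expR (c * t) / c.
  rewrite (Rintegral_derive (ltW t0) cexp dexp)/= mulr0 expR0.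
  by rewrite gerBl divr_ge0// ltW.
have i2 : mu.-integrable `[0, t] (EFin \o (fun r => expR (c * t) / (2 * N) * q r ^+ 2)).
  by apply: integrableZl_EFin.
have i3 : mu.-integrable `[0, t] (EFin \o (fun r => N / 2 * expR (c * r))).
  by apply: integrableZl_EFin.
apply: (@le_trans _ _ (\int[mu]_(r in `[0, t])
    (expR (c * t) / (2 * N) * (q r ^+ 2) + N / 2 * expR (c * r)))).
  apply: le_Rintegral => //.
  - by apply: integrableD_EFin.
  - move=> r; rewrite /= in_itv/= => /andP[r0 rt].
    have er : expR (c * r) <= expR (c * t) by rewrite ler_expR ler_wpM2l// ltW.
    apply: (@le_trans _ _ (expR (c * r) / (2 * N) * q r ^+ 2 + N / 2 * expR (c * r))).
      have -> : expR (c * r) / (2 * N) * q r ^+ 2 + N / 2 * expR (c * r) =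
         expR (c * r) * (q r ^+ 2 / (2 * N) + N / 2) by ring.
      rewrite mulrC ler_wpM2l ?expR_ge0//.
      rewrite -subr_ge0.
      have -> : q r ^+ 2 / (2 * N) + N / 2 - `|q r| = (`|q r| - N) ^+ 2 / (2 * N).
        by rewrite -[q r ^+ 2]real_normK ?num_real//; field; rewrite gt_eqF.
      by rewrite divr_ge0 ?sqr_ge0// mulr_ge0// ltW.
    rewrite lerD2r ler_wpM2r ?sqr_ge0// ler_wpM2r// invr_ge0 mulr_ge0// ltW//.
rewrite RintegralD//.
rewrite !RintegralZl//.
have q2B : \int[mu]_(x in `[0, t]) (q x ^+ 2) <= B.
  rewrite -subr_ge0 /B (Rintegral_itvB iq2) ?bnd_simp ?(ltW t0)//.
  by apply: Rintegral_ge0 => x _; rewrite sqr_ge0.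
apply: (@le_trans _ _ (expR (c * t) / (2 * N) * (eta * N) + N / 2 * (expR (c * t) / c))).
  rewrite lerD//.
    rewrite ler_wpM2l ?divr_ge0 ?expR_ge0 ?mulr_ge0 ?ltW//.
    rewrite (le_lt_trans q2B)// /N mulrDr mulrCA mulfV ?gt_eqF// !mulr1.
    by rewrite ltrDl.
  by rewrite ler_wpM2l// divr_ge0// ltW.
rewrite le_eqVlt; apply/orP; left; apply/eqP; rewrite /c; field.
by rewrite !gt_eqF.
Qed.

(** * The regular solution and its Volterra equation *)

(* The regular solution for the zero potential. *)
Definition sinc_sol (R : realType) (k x : R) : R := sin (k * x) / k.

Lemma is_derive_cos_scale (R : realType) (k x : R) :
  is_derive x (1 : R) (fun x => cos (k * x)) (- (k * sin (k * x))).
Proof.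
have d : is_derive x (1 : R) (fun r => k * r) k.
  rewrite -[X in is_derive _ _ _ X]mulr1.
  exact: (@is_deriveZ _ _ _ id k x 1 1).
have := is_derive1_comp (is_derive_cos (k * x)) d.
by rewrite mulNr mulrC.
Qed.

Lemma is_derive_sinc_sol (R : realType) (k x : R) : k != 0 ->
  is_derive x (1 : R) (sinc_sol k) (cos (k * x)).
Proof.
move=> k0; have d : is_derive x (1 : R) (fun r => k * r) k.
  rewrite -[X in is_derive _ _ _ X]mulr1.
  exact: (@is_deriveZ _ _ _ id k x 1 1).
have -> : sinc_sol k = k^-1 *: (sin \o (fun r => k * r)).
  by apply/funext => y; rewrite !fctE/= /sinc_sol mulrC.
have := is_deriveZ k^-1 (is_derive1_comp (is_derive_sin (k * x)) d).
by rewrite [X in is_derive _ _ _ X]mulrC mulfK.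
Qed.

Lemma is_derive_continuous (R : realType) (f df : R -> R) :
  (forall x, is_derive x (1 : R) f (df x)) -> continuous f.
Proof.
move=> f' x; apply/differentiable_continuous/derivable1_diffP.
by have := f' x.
Qed.

Lemma is_derive_subl (R : realType) (f : R -> R) (x t df : R) :
  is_derive (x - t) (1 : R) f df -> is_derive t (1 : R) (fun t => f (x - t)) (- df).
Proof.
move=> f'; have d : is_derive t (1 : R) (fun r => x - r) (-1).
  have := is_deriveB (is_derive_cst x t (1 : R)) (is_derive_id t (1 : R)).
  by rewrite sub0r.
by have := @is_derive1_comp _ f (fun r => x - r) t df (-1) f' d; rewrite mulrN1.
Qed.

Lemma lipschitz_derive_all (R : realType) (f df : R -> R) (L x y : R) :
  (forall x, is_derive x (1 : R) f (df x)) -> (forall x, `|df x| <= L) ->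
  `|f y - f x| <= L * `|y - x|.
Proof.
move=> f' dfL.
have cf : continuous f by apply: is_derive_continuous f'.
have H a b : a <= b -> `|f b - f a| <= L * (b - a).
  move=> ab; apply: (@lipschitz_derive _ f df) => //.
  exact: continuous_subspaceT.
have [xy|/ltW yx] := leP x y; first by rewrite [`|y - x|]ger0_norm ?subr_ge0// H.
by rewrite distrC [`|y - x|]distrC [`|x - y|]ger0_norm ?subr_ge0// H.
Qed.

Section regular_solution.
Variables (R : realType) (q : R -> R) (k : R) (phi : R -> R).
Hypotheses (q11 : L11 q) (k0 : 0 < k) (regphi : is_regular_solution q k phi).

Lemma regular_solution_continuous (b : R) : {within `[0, b], continuous phi}.
Proof.
case: regphi => dphi [[dp dp0] _ _ phi0 _].
have [b0|b0] := leP b 0; last first.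
  apply/continuous_within_itvP => //; split.
  - move=> x; rewrite in_itv/= => /andP[x0 _].
    by apply/differentiable_continuous/derivable1_diffP; have := dp x x0.
  (* Continuity at 0: the right difference quotient converges, and it is multiplied by [x]. *)
  - rewrite phi0.
    have : (fun x => (phi x - phi 0) / x * x) @ 0^'+ --> dphi 0 * 0.
      apply: cvgM => //; apply: cvg_at_right_filter; exact: cvg_id.
    rewrite mulr0; apply: cvg_trans; apply: near_eq_cvg.
    near=> x; rewrite phi0 subr0 divfK//.
  - apply: cvg_at_left_filter.
    by apply/differentiable_continuous/derivable1_diffP; have := dp b b0.
move: b0; rewrite le_eqVlt => /predU1P[->|b0].
  rewrite set_itv1; exact: continuous_subspace1.
rewrite set_itv_ge; first exact: continuous_subspace0.
by rewrite bnd_simp -ltNge.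
Unshelve. all: by end_near. Qed.

(* Variation of constants: [s (x - t) phi' t + cos (k (x - t)) phi t] has
   derivative [s (x - t) q t phi t] in [t]. *)
Lemma regular_solution_volterra (x : R) : 0 <= x ->
  phi x = sinc_sol k x +
    \int[@lebesgue_measure R]_(t in `[0, x]) (q t * (phi t * sinc_sol k (x - t))).
Proof.
move=> x0; have cphi := @regular_solution_continuous x.
case: regphi => dphi [[dp _] acdp ode phi0 dphi0].
pose s := sinc_sol k.
have ks : k != 0 by rewrite gt_eqF.
have s' y : is_derive y (1 : R) s (cos (k * y)) by exact: is_derive_sinc_sol.
have cs : continuous s by exact: is_derive_continuous s'.
have acx : absolutely_continuous_on 0 x dphi.
  move=> e e0; have [|del del0 H] := acdp (x + 1) _ e e0; first by rewrite ltr_wpDl.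
  exists del => // n c d cd; apply: H => i; have [? ? dx] := cd i.
  by split=> //; rewrite (le_trans dx)// lerDl.
have [M HM] := absolutely_continuous_bounded x0 acx.
have M0 : 0 <= M by rewrite (le_trans _ (HM 0 _)) ?lexx.
have [L HL] : exists L, forall y, 0 <= y <= x -> `|phi y| <= L.
  have cn : {within `[0, x], continuous (fun y => `|phi y|)}.
    by move=> y; apply: cvg_norm; exact: cphi.
  have [c _ Hc] := EVT_max x0 cn.
  by exists `|phi c| => y yx; apply: Hc; rewrite in_itv.
have L0 : 0 <= L by rewrite (le_trans _ (HL 0 _)) ?lexx.
pose C y := cos (k * y).
have C' y : is_derive y (1 : R) C (- (k * sin (k * y))) by exact: is_derive_cos_scale.
pose F t := s (x - t) * dphi t + C (x - t) * phi t.
have phiL c d : 0 <= c -> c <= d -> d <= x -> `|phi d - phi c| <= M * (d - c).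
  move=> c0 cd dx; apply: (@lipschitz_derive _ phi dphi) => //.
  - by move=> y; rewrite in_itv/= => /andP[cy _]; apply: dp; exact: le_lt_trans cy.
  - apply: continuous_subspaceW cphi; apply: subset_itv; rewrite bnd_simp//.
  - move=> y; rewrite in_itv/= => /andP[cy yd]; apply: HM.
    by rewrite (le_trans c0 (ltW cy)) (le_trans (ltW yd) dx).
have sL u v : `|s v - s u| <= `|v - u|.
  rewrite -[leRHS]mul1r; apply: (@lipschitz_derive_all _ s _ 1 u v s') => y.
  by rewrite ler_norml cos_geN1 cos_le1.
have CL u v : `|C v - C u| <= k * `|v - u|.
  apply: (@lipschitz_derive_all _ C _ k u v C') => y.
  rewrite normrN normrM (gtr0_norm k0) ler_piMr ?(ltW k0)//.
  by rewrite ler_norml sin_geN1 sin_le1.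
have sb u : `|s u| <= k^-1.
  rewrite normrM normfV (gtr0_norm k0) ler_piMl ?invr_ge0 ?(ltW k0)//.
  by rewrite ler_norml sin_geN1 sin_le1.
have Cb u : `|C u| <= 1 by rewrite ler_norml cos_geN1 cos_le1.
(* In [F] all factors except [dphi] are Lipschitz and bounded on [[0, x]], so increments of [F] are
   controlled by those of [dphi] and of [t]. *)
have acF : absolutely_continuous_on 0 x F.
  apply: (@absolutely_continuous_le _ _ _ k^-1 (M + (M + k * L)) dphi) => //.
  - by rewrite invr_ge0 ltW.
  - by rewrite !addr_ge0// mulr_ge0// ltW.
  move=> c d c0 cd dx.
  have -> : F d - F c = s (x - d) * (dphi d - dphi c) +
      ((s (x - d) - s (x - c)) * dphi c +
       (C (x - d) * (phi d - phi c) + (C (x - d) - C (x - c)) * phi c)).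
    by rewrite /F; ring.
  have E : `|(x - d) - (x - c)| = d - c.
    by rewrite distrC (_ : _ - _ = d - c) ?ger0_norm ?subr_ge0//; ring.
  have c0x : 0 <= c <= x by rewrite c0 (le_trans cd dx).
  rewrite (le_trans (ler_normD _ _))// lerD//.
    by rewrite normrM ler_wpM2r.
  rewrite [leRHS]mulrDl [X in _ <= _ + X]mulrDl.
  rewrite (le_trans (ler_normD _ _))// lerD//.
    rewrite normrM mulrC ler_pM//; first exact: HM.
    by rewrite -E.
  rewrite (le_trans (ler_normD _ _))// lerD//.
    by rewrite normrM -[leRHS]mul1r ler_pM// phiL.
  rewrite normrM mulrAC ler_pM//; last exact: HL.
  by rewrite -E.
have csx : {within `[0, x], continuous (fun t => phi t * s (x - t))}.
  move=> y; apply: cvgM; first exact: cphi.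
  apply: (continuous_subspaceT (A := `[0, x]) (f := fun t => s (x - t))).
  by apply: is_derive_continuous => t; apply: is_derive_subl; exact: s'.
have iG : (@lebesgue_measure R).-integrable `[0, x]
    (EFin \o (fun t => q t * (phi t * s (x - t)))).
  by apply: integrable_mul_continuous => //; exact: integrable_L11.
have F' : \forall t \ae @lebesgue_measure R, 0 < t < x ->
    is_derive t (1 : R) F (q t * (phi t * s (x - t))).
  have aeF : Filter (almost_everywhere (@lebesgue_measure R)).
    exact: ae_filter_ringOfSetsType.
  apply: filterS ode => t Ht /andP[t0 tx].
  have [ddphi E] := Ht t0.
  have d1 : is_derive t (1 : R) dphi ((q t - k ^+ 2) * phi t).
    apply: DeriveDef => //; rewrite -derive1E.
    by rewrite mulrBl -E; ring.
  have H1 := is_deriveM (is_derive_subl (s' (x - t))) d1.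
  have H2 := is_deriveM (is_derive_subl (C' (x - t))) (dp t t0).
  have H3 : is_derive t (1 : R) F _ := is_deriveD H1 H2.
  apply: (is_derive_eq H3).
  rewrite /C /s /sinc_sol /GRing.scale/=; field.
  exact: ks.
(* The boundary values are [F x = phi x] and [F 0 = s x]. *)
have := absolutely_continuous_FTC2 x0 acF iG F'.
rewrite /F subrr subr0 phi0 dphi0 mulr0 addr0 mulr1 => ->.
by rewrite /s /C /sinc_sol !mulr0 sin0 cos0 !mul0r add0r mul1r subrKC.
Qed.

End regular_solution.

(** * Finite sums of solutions and the wave equation bound *)

Lemma integrable_sum_EFin d (T : measurableType d) (R : realType)
    (mu : {measure set T -> \bar R}) (D : set T) (I : Type) (s : seq I)
    (f : I -> T -> R) : measurable D ->
  (forall i, mu.-integrable D (EFin \o f i)) ->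
  mu.-integrable D (EFin \o (fun x => \sum_(i <- s) f i x)).
Proof.
move=> mD intf; elim: s => [|i s IH].
  by under eq_fun do rewrite big_nil; exact: integrable0.
by under eq_fun do rewrite big_cons; apply: integrableD_EFin.
Qed.

Lemma Rintegral_sum d (T : measurableType d) (R : realType)
    (mu : {measure set T -> \bar R}) (D : set T) (I : Type) (s : seq I)
    (f : I -> T -> R) : measurable D ->
  (forall i, mu.-integrable D (EFin \o f i)) ->
  \int[mu]_(x in D) (\sum_(i <- s) f i x) = \sum_(i <- s) \int[mu]_(x in D) f i x.
Proof.
move=> mD intf; elim: s => [|i s IH].
  under eq_Rintegral do rewrite big_nil.
  by rewrite big_nil Rintegral_cst// mul0r.
under eq_Rintegral do rewrite big_cons.
by rewrite big_cons -IH RintegralD//; exact: integrable_sum_EFin.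
Qed.

Lemma is_derive_sum_seq (R : realType) (I : Type) (s : seq I)
    (f df : I -> R -> R) (x : R) :
  (forall i, is_derive x (1 : R) (f i) (df i x)) ->
  is_derive x (1 : R) (fun x => \sum_(i <- s) f i x) (\sum_(i <- s) df i x).
Proof.
move=> f'; elim: s => [|i s IH].
  by under eq_fun do rewrite big_nil; rewrite big_nil; exact: is_derive_cst.
under eq_fun do rewrite big_cons; rewrite big_cons.
exact: (is_deriveD (f' i) IH).
Qed.

(** This is d'Alembert's formula for the wave with initial position 0 and initial velocity
    [cos (k * y)], at time [a]. *)
Lemma sinc_sol_mul_cos (R : realType) (k a y : R) :
  sinc_sol k a * cos (k * y) = (sinc_sol k (y + a) - sinc_sol k (y - a)) / 2.
Proof.
rewrite /sinc_sol mulrDr mulrBr sinD sinB.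
by move: k^-1 => v; field.
Qed.

Lemma derive_ge0_le (R : realType) (a b : R) (f df : R -> R) :
  (forall t, is_derive t (1 : R) f (df t)) ->
  (forall t, a <= t <= b -> 0 <= df t) ->
  forall u v, a <= u -> u <= v -> v <= b -> f u <= f v.
Proof.
move=> f' df0 u v au uv vb.
have cf := is_derive_continuous f'.
suff : `|(0 : R) - 0| <= f v - f u by rewrite subrr normr0 subr_ge0.
apply: (@ler_norm_increment _ (cst 0) f (cst 0) df u v uv) => //.
- by apply: continuous_subspaceT => t; exact: cst_continuous.
- exact: continuous_subspaceT.
- move=> t; rewrite in_itv/= => /andP[ut tv]; rewrite normr0; apply: df0.
  by rewrite (le_trans au (ltW ut)) (le_trans (ltW tv) vb).
Qed.

Section transmutation.
Variables (R : realType) (q : R -> R) (b : R).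
Hypotheses (q11 : L11 q) (b0 : 0 < b).
Variables (I : Type) (s : seq I) (w k : I -> R) (phi : I -> R -> R).
Hypotheses (k0 : forall i, 0 < k i)
  (regphi : forall i, is_regular_solution q (k i) (phi i)).
Variables (x : R) (m dm : R -> R).
Hypotheses (x0 : 0 <= x) (xb : x <= b)
  (m' : forall t, is_derive t (1 : R) m (dm t))
  (fm : forall t, - x <= t <= x -> `|\sum_(i <- s) w i * sinc_sol (k i) t| <= dm t).

Let mu := @lebesgue_measure R.
Let D t y := \sum_(i <- s) w i * (phi i t - sinc_sol (k i) t) * cos (k i * y).
(** A primitive in [y] of [\sum_i w i * phi i t * cos (k i * y)]. With it, the inner integral of
    Duhamel's formula becomes a difference of two values, and no double integral occurs. *)
Let S t y := \sum_(i <- s) w i * phi i t * sinc_sol (k i) y.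

Let m_le u v : - x <= u -> u <= v -> v <= x -> m u <= m v.
Proof.
apply: (derive_ge0_le m') => t tx; apply: le_trans (fm tx); exact: normr_ge0.
Qed.

Let integrand_integrable t y : 0 <= t ->
  mu.-integrable `[0, t]
    (EFin \o (fun r => q r * ((S r (y + (t - r)) - S r (y - (t - r))) / 2))).
Proof.
move=> t0.
have -> : (fun r => q r * ((S r (y + (t - r)) - S r (y - (t - r))) / 2)) =
    (fun r => \sum_(i <- s) w i * cos (k i * y) * (q r * (phi i r * sinc_sol (k i) (t - r)))).
  apply/funext => r; rewrite /S -sumrB mulr_suml mulr_sumr; apply: eq_bigr => i _.
  rewrite -mulrBr -[_ * _ / 2]mulrA -sinc_sol_mul_cos; ring.
apply: integrable_sum_EFin => // i; apply: integrableZl_EFin => //.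
apply: integrable_mul_continuous => //; first exact: integrable_L11.
move=> z; apply: cvgM; first exact: (regular_solution_continuous (regphi i)).
apply: (continuous_subspaceT (A := `[0, t]) (f := fun r => sinc_sol (k i) (t - r))).
apply: is_derive_continuous => r; apply: is_derive_subl.
Qed.

(** Duhamel's formula: sum the Volterra equations with the factors [w i * cos (k i * y)] and apply
    [sinc_sol_mul_cos] to [sinc_sol (k i) (t - r) * cos (k i * y)]. *)
Let DE t y : 0 <= t ->
  D t y = \int[mu]_(r in `[0, t]) (q r * ((S r (y + (t - r)) - S r (y - (t - r))) / 2)).
Proof.
move=> t0.
transitivity (\int[mu]_(r in `[0, t])
    (\sum_(i <- s) w i * cos (k i * y) * (q r * (phi i r * sinc_sol (k i) (t - r))))); last first.
  apply: eq_Rintegral => r _; rewrite /S -sumrB mulr_suml mulr_sumr; apply: eq_bigr => i _.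
  rewrite -mulrBr -[_ * _ / 2]mulrA -sinc_sol_mul_cos; ring.
have int1 i : mu.-integrable `[0, t] (EFin \o (fun r => q r * (phi i r * sinc_sol (k i) (t - r)))).
  apply: integrable_mul_continuous => //; first exact: integrable_L11.
  move=> z; apply: cvgM; first exact: (regular_solution_continuous (regphi i)).
  apply: (continuous_subspaceT (A := `[0, t]) (f := fun r => sinc_sol (k i) (t - r))).
  apply: is_derive_continuous => r; apply: is_derive_subl.
rewrite Rintegral_sum//; last by move=> i; apply: integrableZl_EFin.
apply: eq_bigr => i _; rewrite RintegralZl//.
rewrite [in LHS](regular_solution_volterra q11 (k0 i) (regphi i) t0).
by rewrite addrAC subrr add0r mulrAC.
Qed.

(** Split [phi] into [sinc_sol] and the difference. The first part of the derivative [P] of [S r] is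
    a mean of free sums at [r + z] and [r - z], bounded by [dm]; the second is [D r z], bounded by
    [E]. The condition on [y] keeps [r + z] and [r - z] in [[- x, x]], and [V] is a primitive of the
    resulting majorant. *)
Let S_increment r y a E : 0 <= r -> 0 <= a -> `|y| <= x - (r + a) ->
  (forall z, `|z| <= x - r -> `|D r z| <= E) -> 0 <= E ->
  `|(S r (y + a) - S r (y - a)) / 2| <= m x - m (- x) + b * E.
Proof.
move=> r0 a0; rewrite ler_norml => /andP[y1 y2] DE' E0.
pose P z := \sum_(i <- s) w i * phi i r * cos (k i * z).
pose V z := m (r + z) / 2 - m (r - z) / 2 + E * z.
have S' z : is_derive z (1 : R) (S r) (P z).
  apply: (@is_derive_sum_seq _ _ _ (fun i z => w i * phi i r * sinc_sol (k i) z)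
     (fun i z => w i * phi i r * cos (k i * z))) => i.
  by apply: is_deriveZ; apply: is_derive_sinc_sol; rewrite gt_eqF.
have V' z : is_derive z (1 : R) V (dm (r + z) / 2 + dm (r - z) / 2 + E).
  have d1 : is_derive z (1 : R) (fun z => m (r + z)) (dm (r + z)).
    have d : is_derive z (1 : R) (fun z => r + z) 1.
      have := is_deriveD (is_derive_cst r z (1 : R)) (is_derive_id z (1 : R)).
      by rewrite add0r.
    by have := @is_derive1_comp _ m (fun z => r + z) z _ _ (m' _) d; rewrite mulr1.
  have d2 : is_derive z (1 : R) (fun z => m (r - z)) (- dm (r - z)).
    exact: is_derive_subl.
  have d3 := is_deriveD (is_deriveB (is_deriveZ (2^-1) d1) (is_deriveZ (2^-1) d2))
    (is_deriveZ E (is_derive_id z (1 : R))).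
  have -> : V = (2^-1 *: (fun z => m (r + z)) - 2^-1 *: (fun z => m (r - z))) + E *: id.
    apply/funext => u; rewrite /V !fctE /GRing.scale/=; ring.
  by apply: (is_derive_eq d3); rewrite /GRing.scale/=; ring.
have cS := is_derive_continuous S'; have cV := is_derive_continuous V'.
have yy : y - a <= y + a by lra.
have H : `|S r (y + a) - S r (y - a)| <= V (y + a) - V (y - a).
  apply: (ler_norm_increment yy (fun z _ => S' z) (fun z _ => V' z)).
  - exact: continuous_subspaceT.
  - exact: continuous_subspaceT.
  move=> z; rewrite in_itv/= => /andP[z1 z2].
  (* Oddness of [sinc_sol] turns the difference in [sinc_sol_mul_cos] into a sum of values at
     [r + z] and [r - z]. *)
  have -> : P z = (\sum_(i <- s) w i * sinc_sol (k i) (r + z)) / 2 +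
      (\sum_(i <- s) w i * sinc_sol (k i) (r - z)) / 2 + D r z.
    rewrite /P /D !mulr_suml -!big_split/=; apply: eq_bigr => i _.
    have -> : sinc_sol (k i) (r - z) = - sinc_sol (k i) (z - r).
      by rewrite /sinc_sol -opprB mulrN sinN mulNr.
    have := sinc_sol_mul_cos (k i) r z; rewrite [r + z]addrC.
    move: (cos _) (sinc_sol _ r) (sinc_sol _ (z + r)) (sinc_sol _ (z - r)).
    move=> C s0 s1 s2 E1.
    have -> : w i * (phi i r - s0) * C = w i * phi i r * C - w i * (s0 * C) by ring.
    by rewrite E1; field.
  have Dz : `|D r z| <= E by apply: DE'; rewrite ler_norml; apply/andP; split; lra.
  have h1 : - x <= r + z <= x by apply/andP; split; lra.
  have h2 : - x <= r - z <= x by apply/andP; split; lra.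
  have f1 := fm h1; have f2 := fm h2.
  apply: (le_trans (ler_normD _ _)); apply: lerD; last exact: Dz.
  by apply: (le_trans (ler_normD _ _)); apply: lerD;
    rewrite normrM normfV (ger0_norm (ler0n _ 2)) ler_wpM2r// invr_ge0.
have M1 : m (r + (y + a)) <= m x by apply: m_le; lra.
have M2 : m (- x) <= m (r + (y - a)) by apply: m_le; lra.
have M3 : m (r - (y - a)) <= m x by apply: m_le; lra.
have M4 : m (- x) <= m (r - (y + a)) by apply: m_le; lra.
rewrite normrM normfV (ger0_norm (ler0n _ 2)).
have ax : r + a <= x by lra.
have ab : a <= b by rewrite (le_trans _ xb)// (le_trans _ ax)// lerDr.
have Ea : E * a <= b * E by rewrite mulrC ler_wpM2r.
have M5 : m (- x) <= m x by apply: m_le; lra.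
move: H; rewrite /V; set N := `| _ |; lra.
Qed.

(* If [K] is the supremum of [|D t y| * expR (- c * t)] over [|y| <= x - t], the
   Duhamel formula gives [K <= M * Q + K / 2]. *)
Lemma transmutation_bound_aux (c : R) : 0 < c ->
  (forall t, 0 <= t <= b -> \int[mu]_(r in `[0, t]) (`|q r| * expR (c * r)) <=
     (2 * b)^-1 * expR (c * t)) ->
  `|\sum_(i <- s) w i * (phi i x - sinc_sol (k i) x)| <=
    2 * (\int[mu]_(r in `[0, b]) `|q r|) * expR (c * b) * (m x - m (- x)).
Proof.
move=> c0 Hc; set Q := \int[mu]_(r in `[0, b]) `|q r|; set M := m x - m (- x).
have xx : - x <= x by rewrite (le_trans _ x0)// oppr_le0.
have M0 : 0 <= M by rewrite /M subr_ge0; apply: m_le.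
have Q0 : 0 <= Q by apply: Rintegral_ge0.
pose A := [set z | exists t y, [/\ 0 <= t, `|y| <= x - t & z = `|D t y| / expR (c * t)]].
have A0 : A (`|D 0 0| / expR (c * 0)).
  by exists 0, 0; split => //; rewrite normr0 subr0.
(* This bound depends on the weights and frequencies. Only finiteness of the supremum matters: it
   allows [K / 2] to be absorbed later. *)
have Aub : has_ubound A.
  have bphi i : exists B, forall t, 0 <= t <= x -> `|phi i t| <= B.
    have cn : {within `[0, x], continuous (fun y => `|phi i y|)}.
      by move=> y; apply: cvg_norm; exact: (regular_solution_continuous (regphi i)).
    have [z _ Hz] := EVT_max x0 cn.
    by exists `|phi i z| => t tx; apply: Hz; rewrite in_itv.
  have [B HB] := choice bphi.
  exists (\sum_(i <- s) `|w i| * (B i + (k i)^-1)).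
  move=> _ [t [y [t0 yt ->]]].
  have tx : 0 <= t <= x by rewrite t0/=; have := le_trans (normr_ge0 y) yt; lra.
  rewrite ler_pdivrMr ?expR_gt0//.
  have S0 : 0 <= \sum_(i <- s) `|w i| * (B i + (k i)^-1).
    apply: sumr_ge0 => i _; rewrite mulr_ge0// addr_ge0//.
      exact: le_trans (normr_ge0 _) (HB i t tx).
    by rewrite invr_ge0 ltW.
  have e1 : 1 <= expR (c * t) by rewrite -expR0 ler_expR mulr_ge0// ltW.
  apply: (@le_trans _ _ (\sum_(i <- s) `|w i| * (B i + (k i)^-1))); last first.
    by rewrite ler_peMr.
  rewrite (le_trans (ler_norm_sum _ _ _))// ler_sum// => i _.
  rewrite !normrM -[leRHS]mulr1 ler_pM//; last by rewrite ler_norml cos_geN1 cos_le1.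
  rewrite ler_wpM2l// (le_trans (ler_normB _ _))// lerD//; first exact: HB.
  rewrite normrM normfV (gtr0_norm (k0 i)) ler_piMl ?invr_ge0 ?(ltW (k0 i))//.
  by rewrite ler_norml sin_geN1 sin_le1.
pose K := sup A.
have K0 : 0 <= K.
  by apply: le_trans (ub_le_sup Aub A0); rewrite divr_ge0 ?expR_ge0.
have DK t y : 0 <= t -> `|y| <= x - t -> `|D t y| <= K * expR (c * t).
  move=> t0 yt; rewrite -ler_pdivrMr ?expR_gt0//; apply: (ub_le_sup Aub).
  by exists t, y.
have step t y : 0 <= t -> `|y| <= x - t ->
    `|D t y| <= (M * Q + K / 2) * expR (c * t).
  move=> t0 yt; have tx : t <= x by have := le_trans (normr_ge0 y) yt; lra.
  have iqt := integrable_norm (integrable_L11 t q11).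
  have iqe : mu.-integrable `[0, t] (EFin \o (fun r => `|q r| * expR (c * r))).
    apply: integrable_mul_continuous => //; apply: continuous_subspaceT => r.
    by apply: continuous_comp; [exact: mulrl_continuous|exact: continuous_expR].
  have i1 : mu.-integrable `[0, t] (EFin \o (fun r => M * `|q r|)).
    exact: integrableZl_EFin.
  have i2 : mu.-integrable `[0, t] (EFin \o (fun r => b * K * (`|q r| * expR (c * r)))).
    exact: integrableZl_EFin.
  rewrite DE//; have iS := integrand_integrable y t0.
  apply: (le_trans (le_normr_Rintegral _ iS)) => //.
  apply: (@le_trans _ _ (\int[mu]_(r in `[0, t])
      (M * `|q r| + b * K * (`|q r| * expR (c * r))))).
    apply: le_Rintegral => //; first exact: integrable_norm.
      exact: integrableD_EFin.
    move=> r; rewrite /= in_itv/= => /andP[r0 rt].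
    rewrite normrM.
    have -> : M * `|q r| + b * K * (`|q r| * expR (c * r)) =
       `|q r| * (M + b * (K * expR (c * r))) by ring.
    rewrite ler_wpM2l//; apply: S_increment => //.
    - by rewrite subr_ge0.
    - by rewrite subrKC.
    - by move=> z; exact: DK.
    - by rewrite mulr_ge0// expR_ge0.
  rewrite RintegralD// !RintegralZl//.
  have qQ : \int[mu]_(r in `[0, t]) `|q r| <= Q.
    have iqb := integrable_norm (integrable_L11 b q11).
    rewrite -subr_ge0 /Q (Rintegral_itvB iqb) ?bnd_simp ?(le_trans tx xb)//.
    by apply: Rintegral_ge0 => r _; exact: normr_ge0.
  have e1 : 1 <= expR (c * t) by rewrite -expR0 ler_expR mulr_ge0// ltW.
  have := Hc t; rewrite t0 (le_trans tx xb) => /(_ isT) Ht.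
  rewrite [leRHS]mulrDl; apply: lerD.
    by rewrite -[leLHS]mulr1 ler_pM// ?mulr_ge0// ?Rintegral_ge0// ler_wpM2l.
  apply: (le_trans (ler_wpM2l _ Ht)); first by rewrite mulr_ge0// ltW.
  rewrite le_eqVlt; apply/orP; left; apply/eqP; field.
  by rewrite gt_eqF.
have KK : K <= M * Q + K / 2.
  apply: ge_sup; first by exists (`|D 0 0| / expR (c * 0)).
  by move=> _ [t [y [t0 yt ->]]]; rewrite ler_pdivrMr ?expR_gt0//; exact: step.
have -> : \sum_(i <- s) w i * (phi i x - sinc_sol (k i) x) = D x 0.
  by apply: eq_bigr => i _; rewrite mulr0 cos0 mulr1.
apply: (le_trans (DK x 0 x0 _)); first by rewrite normr0 subrr.
have eb : expR (c * x) <= expR (c * b) by rewrite ler_expR ler_wpM2l// ltW.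
have -> : 2 * Q * expR (c * b) * M = (2 * (M * Q)) * expR (c * b) by ring.
by rewrite ler_pM// ?expR_ge0//; lra.
Qed.

End transmutation.

(** The point is the order of quantifiers: [C] precedes the weights, the frequencies and the number
    of terms. A classical transformation operator with bounded kernel would give the same
    estimate. *)
Lemma transmutation_bound (R : realType) (q : R -> R) (b : R) :
  L11 q -> 0 < b -> exists2 C : R, 0 <= C &
  forall (I : Type) (s : seq I) (w k : I -> R) (phi : I -> R -> R),
    (forall i, 0 < k i) -> (forall i, is_regular_solution q (k i) (phi i)) ->
  forall (x : R) (m dm : R -> R), 0 <= x <= b ->
    (forall t, is_derive t (1 : R) m (dm t)) ->
    (forall t, - x <= t <= x -> `|\sum_(i <- s) w i * sinc_sol (k i) t| <= dm t) ->
  `|\sum_(i <- s) w i * (phi i x - sinc_sol (k i) x)| <= C * (m x - m (- x)).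
Proof.
move=> q11 b0.
(* The term [b * E] of [S_increment] costs a factor [b], so [eta = 1 / (2 b)] yields the contraction
   factor 1/2. *)
have b20 : 0 < (2 * b)^-1 by rewrite invr_gt0 mulr_gt0.
have [c c0 Hc] := integral_norm_expR_le b0 q11 b20.
exists (2 * (\int[@lebesgue_measure R]_(r in `[0, b]) `|q r|) * expR (c * b)).
  by rewrite !mulr_ge0 ?expR_ge0// Rintegral_ge0.
move=> I s w k phi k0 regphi x m dm /andP[x0 xb] m' fm.
exact: (transmutation_bound_aux q11 b0 k0 regphi x0 xb m' fm c0 Hc).
Qed.

(** * Products of two regular solutions *)

Lemma sinc_sol_mul (R : realType) (k a c : R) :
  sinc_sol k a * sinc_sol k c =
  sinc_sol k ((a + c) / 2) ^+ 2 - sinc_sol k ((a - c) / 2) ^+ 2.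
Proof.
rewrite /sinc_sol.
set u := k * (a / 2); set v := k * (c / 2).
have -> : k * a = u + u by rewrite /u; field.
have -> : k * c = v + v by rewrite /v; field.
have -> : k * ((a + c) / 2) = u + v by rewrite /u /v; field.
have -> : k * ((a - c) / 2) = u - v by rewrite /u /v; field.
rewrite sinB !sinD.
have := cos2Dsin2 u; have := cos2Dsin2 v.
move: (sin u) (cos u) (sin v) (cos v) (k^-1) => su cu sv cv i hv hu.
have -> : (su * cu + cu * su) * i * ((sv * cv + cv * sv) * i) = (2 * su * cu) * (2 * sv * cv) * i ^+ 2 by ring.
ring.
Qed.

Definition sinc_sol_sqr_prim (R : realType) (k t : R) : R :=
  t / (2 * k ^+ 2) - sin (2 * k * t) / (4 * k ^+ 3).

Lemma is_derive_sinc_sol_sqr_prim (R : realType) (k t : R) : k != 0 ->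
  is_derive t (1 : R) (sinc_sol_sqr_prim k) (sinc_sol k t ^+ 2).
Proof.
move=> k0; have d : is_derive t (1 : R) (fun r => 2 * k * r) (2 * k).
  rewrite -[X in is_derive _ _ _ X]mulr1.
  exact: (@is_deriveZ _ _ _ id (2 * k) t 1 1).
have d1 := is_derive1_comp (is_derive_sin (2 * k * t)) d.
have d2 := is_deriveB (is_deriveZ (2 * k ^+ 2)^-1 (is_derive_id t (1 : R)))
  (is_deriveZ (4 * k ^+ 3)^-1 d1).
have -> : sinc_sol_sqr_prim k = (2 * k ^+ 2)^-1 *: id -
    (4 * k ^+ 3)^-1 *: (sin \o (fun r => 2 * k * r)).
  apply/funext => y; rewrite !fctE /sinc_sol_sqr_prim /GRing.scale/=.
  by rewrite mulrC [X in _ - X]mulrC.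
apply: (is_derive_eq d2); rewrite /sinc_sol /GRing.scale/=.
have -> : 2 * k * t = k * t + k * t by ring.
rewrite cosD -!expr2 cos2sin2; field.
exact: k0.
Qed.

Lemma sinc_sol_sqr_primN (R : realType) (k t : R) :
  sinc_sol_sqr_prim k (- t) = - sinc_sol_sqr_prim k t.
Proof. by rewrite /sinc_sol_sqr_prim mulrN sinN; ring. Qed.

Section product.
Variables (R : realType) (b C1 C2 : R).
Hypotheses (C10 : 0 <= C1) (C20 : 0 <= C2).
Variables (I : Type) (s : seq I) (w k : I -> R) (phi1 phi2 : I -> R -> R).
Hypothesis (k0 : forall i, 0 < k i).
(** The weights are quantified here, since the section's [w] gets multiplied by [sinc_sol (k i) y]
    or by [phi2 i x] before the bound is used. *)
Hypothesis T1 : forall (w : I -> R) (x : R) (m dm : R -> R), 0 <= x <= b ->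
    (forall t, is_derive t (1 : R) m (dm t)) ->
    (forall t, - x <= t <= x -> `|\sum_(i <- s) w i * sinc_sol (k i) t| <= dm t) ->
  `|\sum_(i <- s) w i * (phi1 i x - sinc_sol (k i) x)| <= C1 * (m x - m (- x)).
Hypothesis T2 : forall (w : I -> R) (x : R) (m dm : R -> R), 0 <= x <= b ->
    (forall t, is_derive t (1 : R) m (dm t)) ->
    (forall t, - x <= t <= x -> `|\sum_(i <- s) w i * sinc_sol (k i) t| <= dm t) ->
  `|\sum_(i <- s) w i * (phi2 i x - sinc_sol (k i) x)| <= C2 * (m x - m (- x)).

Let g t := \sum_(i <- s) w i * sinc_sol (k i) t ^+ 2.
Let G t := \sum_(i <- s) w i * sinc_sol_sqr_prim (k i) t.
Hypothesis g0 : forall t, 0 <= g t.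

Let G' t : is_derive t (1 : R) G (g t).
Proof.
apply: (@is_derive_sum_seq _ _ _ (fun i t => w i * sinc_sol_sqr_prim (k i) t)
  (fun i t => w i * sinc_sol (k i) t ^+ 2)) => i.
by apply: is_deriveZ; apply: is_derive_sinc_sol_sqr_prim; rewrite gt_eqF.
Qed.

Let GN t : G (- t) = - G t.
Proof.
by rewrite /G -sumrN; apply: eq_bigr => i _; rewrite sinc_sol_sqr_primN mulrN.
Qed.

Let G_le u v : u <= v -> G u <= G v.
Proof. by move=> uv; apply: (@derive_ge0_le _ u v G g G'). Qed.

(** A primitive in [t] of the majorant in [f_le]; the factors 2 compensate the halved arguments. *)
Let m y t := 2 * G ((y + t) / 2) - 2 * G ((y - t) / 2).

Let m' y t : is_derive t (1 : R) (m y) (g ((y + t) / 2) + g ((y - t) / 2)).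
Proof.
have h1 : is_derive t (1 : R) (fun t => (y + t) / 2) (2^-1).
  have -> : (fun t => (y + t) / 2) = 2^-1 *: (cst y + id).
    by apply/funext => u; rewrite !fctE /GRing.scale/= mulrC.
  apply: (is_derive_eq (is_deriveZ (2^-1)
    (is_deriveD (is_derive_cst y t (1 : R)) (is_derive_id t (1 : R))))).
  by rewrite add0r /GRing.scale/= mulr1.
have h2 : is_derive t (1 : R) (fun t => (y - t) / 2) (- 2^-1).
  have -> : (fun t => (y - t) / 2) = 2^-1 *: (cst y - id).
    by apply/funext => u; rewrite !fctE /GRing.scale/= mulrC.
  apply: (is_derive_eq (is_deriveZ (2^-1)
    (is_deriveB (is_derive_cst y t (1 : R)) (is_derive_id t (1 : R))))).
  by rewrite sub0r /GRing.scale/= mulrN1.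
have d1 := @is_derive1_comp _ G (fun t => (y + t) / 2) t _ _ (G' _) h1.
have d2 := @is_derive1_comp _ G (fun t => (y - t) / 2) t _ _ (G' _) h2.
have d3 : is_derive t (1 : R) (m y) _ := is_deriveB (is_deriveZ 2 d1) (is_deriveZ 2 d2).
by apply: (is_derive_eq d3); rewrite /GRing.scale/=; field.
Qed.

Let fE y t : \sum_(i <- s) w i * sinc_sol (k i) y * sinc_sol (k i) t =
  g ((y + t) / 2) - g ((y - t) / 2).
Proof.
by rewrite /g -sumrB; apply: eq_bigr => i _; rewrite -mulrA sinc_sol_mul mulrBr.
Qed.

Let f_le y t : `|\sum_(i <- s) w i * sinc_sol (k i) y * sinc_sol (k i) t| <=
  g ((y + t) / 2) + g ((y - t) / 2).
Proof.
rewrite fE (le_trans (ler_normB _ _))//.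
by rewrite !ger0_norm.
Qed.

(** The increment is [4 * G ((y + x) / 2) - 4 * G ((y - x) / 2)], and [G] is odd and
    nondecreasing. *)
Let m_incr x y : - x <= y <= x -> m y x - m y (- x) <= 8 * G x.
Proof.
move=> /andP[xy yx].
have h1 : G ((y + x) / 2) <= G x by apply: G_le; lra.
have h2 : G (- x) <= G ((y - x) / 2) by apply: G_le; lra.
rewrite /m opprK; rewrite GN in h2; lra.
Qed.

(** Write [phi1 phi2 - s^2 = phi2 (phi1 - s) + s (phi2 - s)] at [x]. The second term is [T2] with
    weights [w s(x)]. For the first, [T1] with weights [w phi2(x)] needs a majorant of
    [\sum w phi2(x) s(t)], which [T2] with weights [w s(t)] supplies. *)
Lemma product_bound_aux (x : R) : 0 <= x <= b ->
  `|\sum_(i <- s) w i * (phi1 i x * phi2 i x) - g x| <=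
    (C1 * (8 + 16 * C2 * b) + 8 * C2) * G x.
Proof.
move=> x0b; have /andP[x0 xb] := x0b.
have Gx0 : 0 <= G x.
  have := @G_le 0 x x0; have := GN 0; rewrite oppr0; lra.
have H2 y : - x <= y <= x ->
    `|\sum_(i <- s) w i * sinc_sol (k i) y * (phi2 i x - sinc_sol (k i) x)| <= 8 * C2 * G x.
  move=> yx; apply: (le_trans (T2 x0b (m' y) (fun t _ => f_le y t))).
  by rewrite -mulrA [leRHS]mulrCA ler_wpM2l// m_incr.
(* The linear term integrates the constant error from [H2]; over [[- x, x]] it contributes at most
   [16 * C2 * b * G x]. *)
pose M t := m x t + 8 * C2 * G x * t.
have M' t : is_derive t (1 : R) M (g ((x + t) / 2) + g ((x - t) / 2) + 8 * C2 * G x).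
  have d : is_derive t (1 : R) M _ :=
    is_deriveD (m' x t) (is_deriveZ (8 * C2 * G x) (is_derive_id t (1 : R))).
  by apply: (is_derive_eq d); rewrite /GRing.scale/= mulr1.
have H1 : `|\sum_(i <- s) w i * phi2 i x * (phi1 i x - sinc_sol (k i) x)| <=
    C1 * (8 + 16 * C2 * b) * G x.
  apply: (le_trans (T1 x0b M' _)).
    move=> t tx.
    have -> : \sum_(i <- s) w i * phi2 i x * sinc_sol (k i) t =
       \sum_(i <- s) w i * sinc_sol (k i) x * sinc_sol (k i) t +
       \sum_(i <- s) w i * sinc_sol (k i) t * (phi2 i x - sinc_sol (k i) x).
      by rewrite -big_split/=; apply: eq_bigr => i _; ring.
    by apply: (le_trans (ler_normD _ _)); apply: lerD; [exact: f_le|exact: H2].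
  rewrite -mulrA ler_wpM2l// /M.
  have h1 := @m_incr x x; rewrite lexx andbT in h1.
  have {}h1 := h1 ltac:(by rewrite (le_trans _ x0)// oppr_le0).
  have h2 : C2 * G x * x <= C2 * G x * b by rewrite ler_wpM2l// mulr_ge0.
  lra.
have -> : \sum_(i <- s) w i * (phi1 i x * phi2 i x) - g x =
    \sum_(i <- s) w i * phi2 i x * (phi1 i x - sinc_sol (k i) x) +
    \sum_(i <- s) w i * sinc_sol (k i) x * (phi2 i x - sinc_sol (k i) x).
  by rewrite /g -sumrB -big_split/=; apply: eq_bigr => i _; ring.
apply: (le_trans (ler_normD _ _)); rewrite mulrDl; apply: lerD; first exact: H1.
by apply: H2; rewrite lexx andbT (le_trans _ x0)// oppr_le0.
Qed.

End product.

Lemma product_bound (R : realType) (q1 q2 : R -> R) (b : R) :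
  L11 q1 -> L11 q2 -> 0 < b -> exists2 M : R, 0 <= M &
  forall (I : Type) (s : seq I) (w k : I -> R) (phi1 phi2 : I -> R -> R),
    (forall i, 0 < k i) ->
    (forall i, is_regular_solution q1 (k i) (phi1 i)) ->
    (forall i, is_regular_solution q2 (k i) (phi2 i)) ->
    (forall t, 0 <= \sum_(i <- s) w i * sinc_sol (k i) t ^+ 2) ->
  forall x : R, 0 <= x <= b ->
  `|\sum_(i <- s) w i * (phi1 i x * phi2 i x) - \sum_(i <- s) w i * sinc_sol (k i) x ^+ 2|
    <= M * \sum_(i <- s) w i * sinc_sol_sqr_prim (k i) x.
Proof.
move=> q11 q21 b0.
have [C1 C10 H1] := transmutation_bound q11 b0.
have [C2 C20 H2] := transmutation_bound q21 b0.
exists (C1 * (8 + 16 * C2 * b) + 8 * C2).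
  by rewrite addr_ge0 ?mulr_ge0 ?addr_ge0 ?mulr_ge0// ltW.
move=> I s w k phi1 phi2 k0 r1 r2 g0 x xb.
apply: (product_bound_aux C10 C20 k0) => //.
  by move=> v y m dm; exact: H1.
by move=> v y m dm; exact: H2.
Qed.

(** * Approximating indicators by combinations of squared sines *)

Section sinc_span.
Variables (R : realType) (kappa : R).
Hypothesis kappa0 : 0 < kappa.

Definition sinc_sqr_span (u : R -> R) := exists s : seq (R * nat),
  forall x, u x = \sum_(p <- s) p.1 * sinc_sol (p.2.+1%:R * kappa) x ^+ 2.

Lemma sinc_sqr_span0 : sinc_sqr_span (fun=> 0).
Proof. by exists [::] => x; rewrite big_nil. Qed.

(** In a list representing an element of the span, the entry [(a, j)] carries the frequency
    [(j + 1) * kappa], so every frequency is positive. *)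
Lemma sinc_sqr_spanD u v : sinc_sqr_span u -> sinc_sqr_span v ->
  sinc_sqr_span (fun x => u x + v x).
Proof.
by move=> [s us] [t vt]; exists (s ++ t) => x; rewrite big_cat us vt.
Qed.

Lemma sinc_sqr_spanZ a u : sinc_sqr_span u -> sinc_sqr_span (fun x => a * u x).
Proof.
move=> [s us]; exists [seq (a * p.1, p.2) | p <- s] => x.
by rewrite big_map us mulr_sumr; apply: eq_bigr => p _; rewrite mulrA.
Qed.

Lemma sinc_sqr_span_sin j : sinc_sqr_span (fun x => sin (j%:R * kappa * x) ^+ 2).
Proof.
case: j => [|j].
  exists [::] => x; rewrite big_nil.
  by rewrite -mulrA mul0r sin0 expr0n.
exists [:: ((j.+1%:R * kappa) ^+ 2, j)] => x; rewrite big_seq1 /sinc_sol/=.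
by rewrite expr_div_n [RHS]mulrC divfK// expf_neq0// mulf_neq0// gt_eqF.
Qed.

Let z x := sin (kappa * x) ^+ 2.

(* [4 sin^2 (j t) sin^2 t = 2 sin^2 (j t) + 2 sin^2 t - sin^2 ((j + 1) t) - sin^2 ((j - 1) t)] *)
Lemma sinc_sqr_spanM u : sinc_sqr_span u -> sinc_sqr_span (fun x => z x * u x).
Proof.
move=> [s us].
have -> : u = (fun x => \sum_(p <- s) p.1 * sinc_sol (p.2.+1%:R * kappa) x ^+ 2).
  exact/funext.
elim: s {us} => [|[a j] s IH].
  have := sinc_sqr_span0; congr sinc_sqr_span.
  by apply/funext => x; rewrite big_nil mulr0.
pose c := a / (j.+1%:R * kappa) ^+ 2 / 4.
have H : sinc_sqr_span (fun x => c * (2 * sin (j.+1%:R * kappa * x) ^+ 2 +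
   2 * sin (1%:R * kappa * x) ^+ 2 + (-1) * sin (j.+2%:R * kappa * x) ^+ 2 +
   (-1) * sin (j%:R * kappa * x) ^+ 2)).
  by apply: sinc_sqr_spanZ; repeat apply: sinc_sqr_spanD; apply: sinc_sqr_spanZ;
    exact: sinc_sqr_span_sin.
have := sinc_sqr_spanD H IH; congr sinc_sqr_span.
apply/funext => x; rewrite [in RHS]big_cons [RHS]mulrDr; congr (_ + _).
rewrite /sinc_sol/= /c /z.
have -> : j.+2%:R * kappa * x = j.+1%:R * kappa * x + kappa * x.
  by rewrite -[j.+2]addn1 natrD; ring.
have -> : j%:R * kappa * x = j.+1%:R * kappa * x - kappa * x.
  by rewrite -[j.+1]addn1 natrD; ring.
rewrite mul1r sinD sinB.
have := cos2Dsin2 (j.+1%:R * kappa * x); have := cos2Dsin2 (kappa * x).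
move: (sin (kappa * x)) (cos (kappa * x)) => s1 c1 h1.
move: (sin (_ * x)) (cos (_ * x)) => s2 c2 h2.
rewrite expr_div_n; move: (_ ^- 2) => v.
have h1' : c1 ^+ 2 = 1 - s1 ^+ 2 by rewrite -h1; ring.
have h2' : c2 ^+ 2 = 1 - s2 ^+ 2 by rewrite -h2; ring.
have -> : 2 * s2 ^+ 2 + 2 * s1 ^+ 2 + -1 * (s2 * c1 + c2 * s1) ^+ 2 +
   -1 * (s2 * c1 - c2 * s1) ^+ 2 =
   2 * s2 ^+ 2 + 2 * s1 ^+ 2 - 2 * (s2 ^+ 2 * c1 ^+ 2 + c2 ^+ 2 * s1 ^+ 2) by ring.
by rewrite h1' h2'; field.
Qed.

Lemma sinc_sqr_spanXM n u : sinc_sqr_span u -> sinc_sqr_span (fun x => z x ^+ n * u x).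
Proof.
move=> uS; elim: n => [|n IH].
  by move: uS; congr sinc_sqr_span; apply/funext => x; rewrite expr0 mul1r.
by have := sinc_sqr_spanM IH; congr sinc_sqr_span; apply/funext => x; rewrite exprS mulrA.
Qed.

Lemma sinc_sqr_span_cut n N :
  sinc_sqr_span (fun x => 1 - (1 - z x ^+ n.+1) ^+ N).
Proof.
have zn : sinc_sqr_span (fun x => z x ^+ n.+1).
  have := sinc_sqr_spanXM n (sinc_sqr_span_sin 1); congr sinc_sqr_span.
  by apply/funext => x; rewrite [RHS]exprSr mul1r.
elim: N => [|N IH].
  by have := sinc_sqr_span0; congr sinc_sqr_span; apply/funext => x; rewrite expr0 subrr.
(* With [v = (1 - u) ^+ N]: [1 - (1 - u) v = (1 - v) + u - u (1 - v)]. *)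
have := sinc_sqr_spanD IH (sinc_sqr_spanD zn (sinc_sqr_spanZ (-1) (sinc_sqr_spanXM n.+1 IH))).
congr sinc_sqr_span; apply/funext => x.
by rewrite [in RHS]exprS; move: (z x ^+ n.+1) (_ ^+ N) => u v; ring.
Qed.

End sinc_span.

Section cut.
Variable R : realType.
Implicit Types (m u z : R).

(* Tends to the indicator of [z > 1 / m] on [0, 1], the number of factors being
   about [m ^+ n.+1]. *)
Definition cut m z (n : nat) : R := 1 - (1 - z ^+ n.+1) ^+ (Num.truncn (m ^+ n.+1)).+1.

Lemma cut_ge0 m z n : 0 <= z <= 1 -> 0 <= cut m z n.
Proof.
move=> /andP[z0 z1]; have u0 := exprn_ge0 n.+1 z0; have u1 := exprn_ile1 n.+1 z0 z1.
by rewrite subr_ge0 exprn_ile1// ?subr_ge0// gerBl.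
Qed.

Lemma cut_le1 m z n : 0 <= z <= 1 -> cut m z n <= 1.
Proof.
move=> /andP[z0 z1]; have u1 := exprn_ile1 n.+1 z0 z1.
by rewrite gerBl exprn_ge0// subr_ge0.
Qed.

Lemma cut_le m1 m2 z n : 0 <= m1 -> m1 <= m2 -> 0 <= z <= 1 -> cut m1 z n <= cut m2 z n.
Proof.
move=> m0 m12 /andP[z0 z1]; have u0 := exprn_ge0 n.+1 z0; have u1 := exprn_ile1 n.+1 z0 z1.
rewrite lerD2l lerN2 ler_wiXn2l ?subr_ge0 ?gerBl// ltnS.
by apply: le_truncn; rewrite lerXn2r// nnegrE (le_trans m0).
Qed.

Lemma bernoulli_lower u N : 0 <= u <= 1 -> 1 - (1 - u) ^+ N <= N%:R * u.
Proof.
move=> /andP[u0 u1]; elim: N => [|N IH]; first by rewrite expr0 subrr mul0r.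
have : (1 - u) ^+ N <= 1 by rewrite exprn_ile1 ?subr_ge0// gerBl.
rewrite exprS -natr1; move: (_ ^+ N) IH => v IH v1.
have : 0 <= (1 - v) * u by rewrite mulr_ge0// subr_ge0.
nra.
Qed.

Lemma bernoulli_upper u N : 0 <= u <= 1 -> (1 - u) ^+ N * (1 + N%:R * u) <= 1.
Proof.
move=> /andP[u0 u1]; elim: N => [|N IH]; first by rewrite expr0 mul0r addr0 mulr1.
apply: le_trans IH; rewrite exprSr -mulrA ler_wpM2l ?exprn_ge0 ?subr_ge0//.
rewrite -natr1; have : 0 <= (N%:R + 1) * u ^+ 2 by rewrite mulr_ge0 ?addr_ge0 ?sqr_ge0.
rewrite expr2; nra.
Qed.

(** With [N] factors, [cut m z n <= N z^(n+1) <= (m z)^(n+1) + z^(n+1)]; the last term comes from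
    the successor in the exponent. *)
Lemma cvg_cut0 m z : 1 <= m -> 0 <= z -> m * z < 1 -> cut m z n @[n --> \oo] --> (0 : R).
Proof.
move=> m1 z0 mz.
have z1 : z < 1 by apply: le_lt_trans mz; rewrite ler_peMl.
have H : (fun n => (m * z) ^+ n.+1 + z ^+ n.+1) @ \oo --> (0 : R).
  rewrite -[X in _ --> X](addr0 0); apply: cvgD.
    rewrite (cvg_shiftS (fun n => (m * z) ^+ n)); apply: cvg_expr.
    by rewrite ger0_norm// mulr_ge0// (le_trans _ m1).
  by rewrite (cvg_shiftS (fun n => z ^+ n)); apply: cvg_expr; rewrite ger0_norm.
apply: (squeeze_cvgr _ (cvg_cst 0) H); apply: nearW => n.
have z01 : 0 <= z <= 1 by rewrite z0 ltW.
rewrite cut_ge0//=.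
have u0 := exprn_ge0 n.+1 z0; have u1 := exprn_ile1 n.+1 z0 (ltW z1).
apply: (le_trans (bernoulli_lower _ _)); first by rewrite u0.
rewrite exprMn -[X in _ + X]mul1r -mulrDl ler_wpM2r//.
rewrite -natr1 lerD2r truncn_le//.
by rewrite exprn_ge0// (le_trans _ m1).
Qed.

(** With [u = z^(n+1)] and [N >= m^(n+1)] factors, [(1 - u)^N <= 1 / (1 + N u) <= (m z)^(-(n+1))].
    The successor in the exponent ensures this lower bound on [N]. *)
Lemma cvg_cut1 m z : 0 <= m -> 0 <= z <= 1 -> 1 < m * z -> cut m z n @[n --> \oo] --> (1 : R).
Proof.
move=> m0 /andP[z0 z1] mz.
have mz0 : 0 < m * z by rewrite (lt_trans _ mz).
have H : (fun n => 1 - (m * z)^-1 ^+ n.+1) @ \oo --> (1 : R).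
  rewrite -[X in _ --> X]subr0; apply: cvgB; first exact: cvg_cst.
  rewrite (cvg_shiftS (fun n => (m * z)^-1 ^+ n)); apply: cvg_expr.
  by rewrite ger0_norm ?invr_ge0 ?(ltW mz0)// invf_lt1.
apply: (squeeze_cvgr _ H (cvg_cst (1 : R))); apply: nearW => n.
have z01 : 0 <= z <= 1 by rewrite z0.
rewrite cut_le1// andbT lerD2l lerN2.
have u0 := exprn_ge0 n.+1 z0; have u1 := exprn_ile1 n.+1 z0 z1.
set N := (Num.truncn _).+1.
have mN : m ^+ n.+1 <= N%:R by rewrite ltW// truncnS_gt.
have B := @bernoulli_upper (z ^+ n.+1) N ltac:(by rewrite u0).
rewrite exprVn exprMn -div1r ler_pdivlMr -?exprMn ?exprn_gt0//.
apply: le_trans B; rewrite ler_wpM2l ?exprn_ge0 ?subr_ge0//.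
rewrite exprMn (@le_trans _ _ (N%:R * z ^+ n.+1))//; first by rewrite ler_wpM2r.
by rewrite lerDr.
Qed.

End cut.

Lemma sqr_sin_lt (R : realType) (u v : R) : 0 <= u -> u < v -> v <= pi / 2 ->
  sin u ^+ 2 < sin v ^+ 2.
Proof.
move=> u0 uv vpi; have p0 := pi_gt0 R.
have h1 : 0 < sin (v + u) by apply: sin_gt0_pi; apply/andP; split; lra.
have h2 : 0 < sin (v - u) by apply: sin_gt0_pi; apply/andP; split; lra.
rewrite -subr_gt0.
have -> : sin v ^+ 2 - sin u ^+ 2 = sin (v + u) * sin (v - u); last exact: mulr_gt0.
rewrite sinB sinD; have := cos2Dsin2 u; have := cos2Dsin2 v.
move: (sin u) (cos u) (sin v) (cos v) => su cu sv cv hv hu.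
have -> : (sv * cu + cv * su) * (sv * cu - cv * su) = sv ^+ 2 * cu ^+ 2 - cv ^+ 2 * su ^+ 2 by ring.
have -> : cu ^+ 2 = 1 - su ^+ 2 by rewrite -hu; ring.
have -> : cv ^+ 2 = 1 - sv ^+ 2 by rewrite -hv; ring.
ring.
Qed.

(** The choice of [kappa] maps [[0, b]] onto [[0, pi / 2]], where [sin^2] is strictly increasing, so
    thresholds for [z x] are thresholds for [x]. Subtracting the cut at [d] from the cut at [c]
    leaves [(c, d)]; monotonicity of [cut] in [m] keeps the difference nonnegative. *)
Lemma sinc_sqr_span_indic (R : realType) (b c d : R) : 0 < c -> c < d -> d < b ->
  exists u : nat -> R -> R,
  [/\ forall n, sinc_sqr_span (pi / 2 / b) (u n),
      forall n x, 0 <= u n x <= 1 &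
      forall x, 0 <= x <= b -> x != c -> x != d ->
        u n x @[n --> \oo] --> (\1_(`]c, d[%classic : set R) x : R)].
Proof.
move=> c0 cd db; set kappa := pi / 2 / b; have p0 := pi_gt0 R.
have d0 := lt_trans c0 cd; have b0 := lt_trans d0 db.
have kappa0 : 0 < kappa by rewrite !divr_gt0.
pose z x := sin (kappa * x) ^+ 2.
have z01 x : 0 <= z x <= 1 by rewrite sqr_ge0 -(cos2Dsin2 (kappa * x)) lerDr sqr_ge0.
have z_lt x y : 0 <= x -> x < y -> y <= b -> z x < z y.
  move=> x0 xy yb; apply: sqr_sin_lt; first by rewrite mulr_ge0// ltW.
    by rewrite ltr_pM2l.
  by rewrite /kappa -mulrA ler_piMr ?divr_ge0 ?(ltW p0)// mulrC ler_pdivrMr ?mul1r.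
have z0 : z 0 = 0 by rewrite /z mulr0 sin0 expr0n.
have zc0 : 0 < z c by rewrite -z0 z_lt// (ltW (lt_trans cd db)).
have zd0 : 0 < z d by rewrite -z0 z_lt// ltW.
have zcd : z c < z d by rewrite z_lt// ltW.
have [_ zc1] := andP (z01 c); have [_ zd1] := andP (z01 d).
exists (fun n x => cut (z c)^-1 (z x) n - cut (z d)^-1 (z x) n); split.
- move=> n; have := sinc_sqr_spanD (sinc_sqr_span_cut kappa0 n (Num.truncn ((z c)^-1 ^+ n.+1)).+1)
    (sinc_sqr_spanZ (-1) (sinc_sqr_span_cut kappa0 n (Num.truncn ((z d)^-1 ^+ n.+1)).+1)).
  by congr sinc_sqr_span; apply/funext => x; rewrite mulN1r.
- move=> n x; rewrite subr_ge0 cut_le//=.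
  + rewrite lerBlDr (le_trans (cut_le1 _ _ _))// lerDl cut_ge0//.
  + by rewrite invr_ge0 ltW.
  + by rewrite lef_pV2 ?posrE// ltW.
- move=> x /andP[x0 xb] xc xd.
  have zx0 : 0 <= z x by case/andP: (z01 x).
  have low y : 0 < z y -> z y <= 1 -> x < y -> y <= b ->
      cut (z y)^-1 (z x) n @[n --> \oo] --> (0 : R).
    move=> y0 y1 xy yb; apply: cvg_cut0 => //; first by rewrite invf_ge1.
    by rewrite mulrC ltr_pdivrMr// mul1r z_lt.
  have high y : 0 < z y -> 0 <= y -> y < x ->
      cut (z y)^-1 (z x) n @[n --> \oo] --> (1 : R).
    move=> y0 y1 yx; apply: cvg_cut1 => //; first by rewrite invr_ge0 ltW.
    by rewrite mulrC ltr_pdivlMr// mul1r z_lt.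
  rewrite indicE; case: (ltgtP x c) xc => // xc _.
    rewrite memNset; last by rewrite /= in_itv/= ltNge (ltW xc).
    rewrite -[X in _ --> X](subr0 (0 : R)).
    apply: cvgB; apply: low => //; [exact: ltW (lt_trans cd db)|exact: lt_trans cd|exact: ltW].
  case: (ltgtP x d) xd => // xd _.
    rewrite mem_set; last by rewrite /= in_itv/= xc.
    rewrite -[X in _ --> X](subr0 (1 : R)).
    by apply: cvgB; [apply: high => //; exact: ltW|apply: low => //; exact: ltW].
  rewrite memNset; last by rewrite /= in_itv/= [x < d]ltNge (ltW xd) andbF.
  rewrite -[X in _ --> X](subrr (1 : R)).
  by apply: cvgB; apply: high => //; exact: ltW.
Qed.

(** * Testing [h] against the approximants and passing to the limit *)

Lemma Rintegral_dominated_cvg d (T : measurableType d) (R : realType)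
    (mu : {measure set T -> \bar R}) (D : set T) (f_ : nat -> T -> R) (f g : T -> R) :
  measurable D -> (forall n, measurable_fun D (f_ n)) -> measurable_fun D f ->
  (\forall x \ae mu, D x -> f_ n x @[n --> \oo] --> f x) ->
  mu.-integrable D (EFin \o g) ->
  (forall n x, D x -> `|f_ n x| <= g x) ->
  mu.-integrable D (EFin \o f) /\
  \int[mu]_(x in D) f_ n x @[n --> \oo] --> \int[mu]_(x in D) f x.
Proof.
move=> mD mf_ mf f_f ig fg.
have [||||intf _] := @dominated_convergence _ _ _ mu D mD (fun n => EFin \o f_ n)
  (EFin \o f) (EFin \o g) _ _ _ ig.
- by move=> n; apply/measurable_EFinP.
- exact/measurable_EFinP.
- have aeF := ae_filter_ringOfSetsType mu.
  by apply: filterS f_f => x H /H Hx; apply: cvg_EFin => //; exact: nearW.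
- by apply: aeW => x n Dx; rewrite lee_fin; exact: fg.
move=> H; split => //; apply: fine_cvg.
by rewrite fineK//; exact: integrable_fin_num.
Qed.

Lemma is_derive_sinc_sol_sqr (R : realType) (k x : R) : k != 0 ->
  is_derive x (1 : R) (fun x => sinc_sol k x ^+ 2) (2 * sinc_sol k x * cos (k * x)).
Proof.
move=> k0; have d := is_derive_sinc_sol x k0.
have -> : (fun x => sinc_sol k x ^+ 2) = sinc_sol k * sinc_sol k.
  by apply/funext => y; rewrite !fctE expr2.
apply: (is_derive_eq (is_deriveM d d)); rewrite /GRing.scale/=; ring.
Qed.

Lemma sinc_sqr_span_continuous (R : realType) (kappa : R) (u : R -> R) :
  0 < kappa -> sinc_sqr_span kappa u -> continuous u.
Proof.
move=> kappa0 [s us]; rewrite (funext us).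
apply: (@is_derive_continuous _ _ (fun x => \sum_(p <- s)
   p.1 * (2 * sinc_sol (p.2.+1%:R * kappa) x * cos (p.2.+1%:R * kappa * x)))) => x.
apply: (@is_derive_sum_seq _ _ _ (fun p x => p.1 * sinc_sol (p.2.+1%:R * kappa) x ^+ 2)
  (fun p x => p.1 * (2 * sinc_sol (p.2.+1%:R * kappa) x * cos (p.2.+1%:R * kappa * x)))) => p.
by apply: is_deriveZ; apply: is_derive_sinc_sol_sqr; rewrite mulf_neq0// gt_eqF.
Qed.

Lemma integrableB_EFin d (T : measurableType d) (R : realType)
    (mu : {measure set T -> \bar R}) (D : set T) (f g : T -> R) :
  measurable D -> mu.-integrable D (EFin \o f) -> mu.-integrable D (EFin \o g) ->
  mu.-integrable D (EFin \o (fun x => f x - g x)).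
Proof. by move=> mD intf intg; exact: (integrableB mD intf intg). Qed.

Lemma Rintegral_cst_itv (R : realType) (x y : bool) (a b r : R) : a <= b ->
  \int[@lebesgue_measure R]_(_ in [set` Interval (BSide x a) (BSide y b)]) r = r * (b - a).
Proof.
move=> ab; rewrite Rintegral_cst//; congr (_ * _).
transitivity (fine (@lebesgue_measure R [set` Interval (BSide x a) (BSide y b)])) => //.
rewrite lebesgue_measure_itv/= lte_fin; case: ltP => //= ba.
by rewrite (@le_anti _ _ a b) ?ab// subrr.
Qed.

Section main_inequality.
Variables (R : realType) (q1 q2 : R -> R) (b M : R) (h : R -> R) (phi1 phi2 : R -> R -> R).
Let mu := @lebesgue_measure R.
Hypotheses (b0 : 0 < b) (M0 : 0 <= M).
Hypothesis HM : forall (I : Type) (s : seq I) (w k : I -> R) (phi1 phi2 : I -> R -> R),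
    (forall i, 0 < k i) ->
    (forall i, is_regular_solution q1 (k i) (phi1 i)) ->
    (forall i, is_regular_solution q2 (k i) (phi2 i)) ->
    (forall t, 0 <= \sum_(i <- s) w i * sinc_sol (k i) t ^+ 2) ->
  forall x : R, 0 <= x <= b ->
  `|\sum_(i <- s) w i * (phi1 i x * phi2 i x) - \sum_(i <- s) w i * sinc_sol (k i) x ^+ 2|
    <= M * \sum_(i <- s) w i * sinc_sol_sqr_prim (k i) x.
Hypothesis r1 : forall k, 0 < k -> is_regular_solution q1 k (phi1^~ k).
Hypothesis r2 : forall k, 0 < k -> is_regular_solution q2 k (phi2^~ k).
Hypothesis ih : mu.-integrable `[0, b] (EFin \o h).
Hypothesis h0 : forall k, 0 < k ->
  \int[mu]_(x in `[0, b]) (h x * (phi1 x k * phi2 x k)) = 0.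

Let kappa := pi / 2 / b.
Let kappa0 : 0 < kappa. Proof. by rewrite !divr_gt0// pi_gt0. Qed.

Lemma span_test_inequality (u : R -> R) : sinc_sqr_span kappa u ->
  (forall x, 0 <= u x) ->
  `|\int[mu]_(x in `[0, b]) (h x * u x)| <=
    M * \int[mu]_(x in `[0, b]) (`|h x| * \int[mu]_(t in `[0, x]) u t).
Proof.
move=> uS u0; have cu := sinc_sqr_span_continuous kappa0 uS.
have [s us] := uS.
pose k (p : R * nat) := p.2.+1%:R * kappa.
have k0 p : 0 < k p by rewrite mulr_gt0.
pose w (p : R * nat) := p.1.
pose g x := \sum_(p <- s) w p * (phi1 x (k p) * phi2 x (k p)).
pose G x := \sum_(p <- s) w p * sinc_sol_sqr_prim (k p) x.
have G' x : is_derive x (1 : R) G (u x).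
  rewrite us; apply: (@is_derive_sum_seq _ _ _ (fun p x => w p * sinc_sol_sqr_prim (k p) x)
    (fun p x => w p * sinc_sol (k p) x ^+ 2)) => p.
  by apply: is_deriveZ; apply: is_derive_sinc_sol_sqr_prim; rewrite gt_eqF.
have GE x : 0 <= x -> \int[mu]_(t in `[0, x]) u t = G x.
  move=> x0; rewrite (Rintegral_derive x0 cu G').
  have -> : G 0 = 0.
    rewrite /G big1// => p _.
    by rewrite /sinc_sol_sqr_prim mulr0 sin0 !mul0r subr0 mulr0.
  by rewrite subr0.
have cG : continuous G := is_derive_continuous G'.
have ihp p : mu.-integrable `[0, b] (EFin \o (fun x => h x * (phi1 x (k p) * phi2 x (k p)))).
  apply: integrable_mul_continuous => //; first exact: ltW.
  move=> x; apply: cvgM.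
    exact: (regular_solution_continuous (r1 (k0 p))).
  exact: (regular_solution_continuous (r2 (k0 p))).
have ihw p : mu.-integrable `[0, b]
    (EFin \o (fun x => w p * (h x * (phi1 x (k p) * phi2 x (k p))))).
  exact: integrableZl_EFin.
have hgE : (fun x => h x * g x) =
    (fun x => \sum_(p <- s) w p * (h x * (phi1 x (k p) * phi2 x (k p)))).
  by apply/funext => x; rewrite /g mulr_sumr; apply: eq_bigr => p _; rewrite mulrCA.
have ihg : mu.-integrable `[0, b] (EFin \o (fun x => h x * g x)).
  by rewrite hgE; apply: integrable_sum_EFin.
have hg0 : \int[mu]_(x in `[0, b]) (h x * g x) = 0.
  rewrite hgE Rintegral_sum//; apply: big1 => p _.
  by rewrite RintegralZl// h0 ?mulr0.
have ihu : mu.-integrable `[0, b] (EFin \o (fun x => h x * u x)).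
  apply: integrable_mul_continuous => //; first exact: ltW.
  exact: continuous_subspaceT.
have ihG : mu.-integrable `[0, b] (EFin \o (fun x => `|h x| * G x)).
  apply: integrable_mul_continuous => //; first exact: ltW.
    exact: integrable_norm.
  exact: continuous_subspaceT.
have ihgu : mu.-integrable `[0, b] (EFin \o (fun x => h x * g x - h x * u x)).
  exact: integrableB_EFin.
have -> : `|\int[mu]_(x in `[0, b]) (h x * u x)| =
    `|\int[mu]_(x in `[0, b]) (h x * g x - h x * u x)|.
  by rewrite RintegralB// hg0 sub0r normrN.
have -> : \int[mu]_(x in `[0, b]) (`|h x| * \int[mu]_(t in `[0, x]) u t) =
    \int[mu]_(x in `[0, b]) (`|h x| * G x).
  by apply: eq_Rintegral => x; rewrite inE/= in_itv/= => /andP[x0 _]; rewrite GE.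
rewrite -RintegralZl//.
apply: (le_trans (le_normr_Rintegral _ ihgu)) => //.
apply: le_Rintegral => //; first exact: integrable_norm.
  exact: integrableZl_EFin.
move=> x; rewrite /= in_itv/= => xb.
rewrite -mulrBr normrM mulrCA ler_wpM2l// us.
apply: (HM (phi1 := fun p x => phi1 x (k p)) (phi2 := fun p x => phi2 x (k p))) => //.
- by move=> p; exact: (r1 (k0 p)).
- by move=> p; exact: (r2 (k0 p)).
- by move=> t; have := u0 t; rewrite us.
Qed.

Lemma interval_test_inequality (c d : R) : 0 < c -> c < d -> d < b ->
  `|\int[mu]_(x in `]c, d[) h x| <= M * (d - c) * \int[mu]_(x in `]c, b]) `|h x|.
Proof.
move=> c0 cd db.
have [u [uS u01 ulim]] := sinc_sqr_span_indic c0 cd db.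
have cu n : continuous (u n) := sinc_sqr_span_continuous kappa0 (uS n).
have u0 n x : 0 <= u n x by case/andP: (u01 n x).
have u1 n x : u n x <= 1 by case/andP: (u01 n x).
pose P : set R := `]c, d[%classic.
pose J x : R := \1_P x.
have mP : measurable P by exact: measurable_itv.
have mJ D : measurable_fun D J by exact: measurable_indic.
have mu_ n D : measurable_fun D (u n).
  by apply: measurable_funTS; exact: continuous_measurable_fun.
have cd0 : mu.-negligible ([set c] `|` [set d]).
  by apply: negligibleU; apply/negligibleP => //; exact: lebesgue_measure_set1.
have aeu : \forall x \ae mu, 0 <= x <= b -> u n x @[n --> \oo] --> J x.
  apply: negligibleS cd0 => x /= H; apply: contrapT => xcd; apply: H => xb.
  by apply: ulim => //; apply/eqP => E; apply: xcd; [left|right].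
have aeF : Filter (almost_everywhere mu) := ae_filter_ringOfSetsType mu.
have mh : measurable_fun `[0, b] h.
  by case/integrableP : ih => /measurable_EFinP.
have ihn := integrable_norm ih.
pose G n x := \int[mu]_(t in `[0, x]) u n t.
pose GJ x := \int[mu]_(t in `[0, x]) J t.
have i1 x : mu.-integrable `[0, x] (EFin \o (cst (1 : R))).
  by apply: integrable_continuous_itv; apply: continuous_subspaceT => y; exact: cst_continuous.
have int1 x : 0 <= x -> \int[mu]_(t in `[0, x]) (1 : R) = x.
  have c1 : continuous (fun _ : R => 1 : R) by move=> y; exact: cst_continuous.
  have d1 (y : R) : is_derive y (1 : R) id (1 : R) := is_derive_id y 1.
  by move=> x0; rewrite (Rintegral_derive x0 c1 d1) subr0.
have iu n x : mu.-integrable `[0, x] (EFin \o (u n)).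
  by apply: integrable_continuous_itv; exact: continuous_subspaceT.
have Glim x : 0 <= x <= b -> mu.-integrable `[0, x] (EFin \o J) /\ G n x @[n --> \oo] --> GJ x.
  move=> /andP[x0 xb]; apply: (@Rintegral_dominated_cvg _ _ _ _ _ _ _ (cst 1)) => //.
  - by move=> n; exact: mu_.
  - exact: mJ.
  - apply: filterS aeu => y Hy; rewrite /= in_itv/= => /andP[y0 yx].
    by apply: Hy; rewrite y0 (le_trans yx).
  - by move=> n y _; rewrite ger0_norm.
have G0 n x : 0 <= G n x by apply: Rintegral_ge0.
have Gx n x : 0 <= x -> G n x <= x.
  by move=> x0; rewrite -[leRHS]int1//; apply: le_Rintegral.
have cG n : {within `[0, b], continuous (G n)}.
  exact: (parameterized_integral_continuous (ltW b0) (iu n b)).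
have ihG n : mu.-integrable `[0, b] (EFin \o (fun x => `|h x| * G n x)).
  by apply: integrable_mul_continuous => //; exact: ltW.
have ihu n : mu.-integrable `[0, b] (EFin \o (fun x => h x * u n x)).
  apply: integrable_mul_continuous => //; first exact: ltW.
  exact: continuous_subspaceT.
have mhG n : measurable_fun `[0, b] (fun x => `|h x| * G n x).
  by case/integrableP : (ihG n) => /measurable_EFinP.
have mGJ : measurable_fun `[0, b] GJ.
  have mG n : measurable_fun `[0, b] (G n).
    by apply: subspace_continuous_measurable_fun => //; exact: cG.
  apply: (@measurable_fun_cvg _ _ _ `[0, b] G) => // x.
  by rewrite /= in_itv/= => xb; exact: (Glim x xb).2.
have [||||||_ L1] := @Rintegral_dominated_cvg _ _ _ (@lebesgue_measure R) `[0, b]%classic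
    (fun n x => h x * u n x) (fun x => h x * J x) (fun x => `|h x|).
  - exact: measurable_itv.
  - by move=> n; apply: measurable_funM; [exact: mh|exact: mu_].
  - by apply: measurable_funM; [exact: mh|exact: mJ].
  - apply: filterS aeu => y Hy; rewrite /= in_itv/= => yb.
    by apply: cvgM; [exact: cvg_cst|exact: Hy].
  - exact: ihn.
  - by move=> n x _; rewrite normrM ler_piMr// ger0_norm.
(* The dominating function comes from [G n x <= x <= b]. *)
have [||||||ihGJ L2] := @Rintegral_dominated_cvg _ _ _ (@lebesgue_measure R) `[0, b]%classic
    (fun n x => `|h x| * G n x) (fun x => `|h x| * GJ x) (fun x => b * `|h x|).
  - exact: measurable_itv.
  - by move=> n; exact: mhG.
  - by apply: measurable_funM => //; exact: measurableT_comp.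
  - apply: aeW => y; rewrite /= in_itv/= => yb.
    by apply: cvgM; [exact: cvg_cst|exact: (Glim y yb).2].
  - exact: integrableZl_EFin.
  - move=> n x; rewrite /= in_itv/= => /andP[x0 xb].
    rewrite normrM normr_id mulrC ler_wpM2r// ger0_norm//.
    by rewrite (le_trans (Gx n x x0)).
have main : `|\int[mu]_(x in `[0, b]) (h x * J x)| <=
    M * \int[mu]_(x in `[0, b]) (`|h x| * GJ x).
  have L1' : `|\int[mu]_(x in `[0, b]) (h x * u n x)| @[n --> \oo] -->
      `|\int[mu]_(x in `[0, b]) (h x * J x)| by apply: cvg_norm.
  have L2' : M * (\int[mu]_(x in `[0, b]) (`|h x| * G n x)) @[n --> \oo] -->
      M * \int[mu]_(x in `[0, b]) (`|h x| * GJ x).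
    by apply: cvgM L2; exact: cvg_cst.
  have := @ler_cvg_to _ _ _ R _ _ _ _ L1' L2'.
  apply.
  by apply: nearW => n; exact: (span_test_inequality (uS n) (u0 n)).
have hJ (D : set R) (f : R -> R) : (fun x => f x * \1_D x) = f \_ D.
  apply/funext => x; rewrite patchE indicE.
  by case: (x \in D); rewrite ?mulr1 ?mulr0.
have Pb : P `<=` `[0, b].
  by move=> x; rewrite /P/= !in_itv/= => /andP[xc xd]; apply/andP; split; lra.
move: main; rewrite /J hJ -Rintegral_mkcondr (setIidr Pb) => main.
apply: (le_trans main); rewrite -mulrA ler_wpM2l//.
have Qb : `]c, b] `<=` `[0, b].
  by move=> x; rewrite /= !in_itv/= => /andP[xc xd]; apply/andP; split; lra.
have iQ : mu.-integrable `[0, b] (EFin \o (fun x => `|h x| * \1_(`]c, b] : set R) x)).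
  apply: (@le_integrable _ _ _ (@lebesgue_measure R) _ (measurable_itv _) _
    (EFin \o (fun x => `|h x|)) _ _ ihn).
    apply/measurable_EFinP; apply: measurable_funM; first exact: measurableT_comp.
    exact: measurable_indic.
  move=> x _; rewrite /= lee_fin normrM normr_id ler_piMr//.
  by rewrite indicE; case: (_ \in _); rewrite ?normr1 ?normr0.
rewrite -(setIidr Qb) Rintegral_mkcondr -hJ -RintegralZl//.
apply: le_Rintegral => //; first exact: integrableZl_EFin.
move=> x; rewrite /= in_itv/= => /andP[x0 xb].
rewrite mulrCA ler_wpM2l//.
(* [GJ x] is the length of the part of [(c, d)] below [x]: it is 0 for [x <= c], which restricts the
   integral to []c, b]], and at most [d - c] beyond. *)
have [xc|cx] := leP x c.
  rewrite /GJ (@eq_Rintegral _ _ _ _ _ (cst 0)); last first.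
    move=> y; rewrite inE/= in_itv/= => /andP[y0 yx].
    by rewrite /J indicE memNset// /P/= in_itv/= ltNge (le_trans yx xc).
  rewrite Rintegral_cst// mul0r mulr_ge0 ?subr_ge0 ?(ltW cd)//.
rewrite indicE mem_set/=; last by rewrite in_itv/= cx.
rewrite mulr1.
have [iJx _] := Glim x ltac:(by rewrite x0).
have [iJb _] := Glim b ltac:(by rewrite lexx ltW).
apply: (@le_trans _ _ (GJ b)).
  rewrite -subr_ge0 /GJ (Rintegral_itvB iJb) ?bnd_simp//.
  by apply: Rintegral_ge0 => y _; rewrite /J indicE.
have -> : GJ b = \int[mu]_(t in `[0, b]) ((fun _ : R => 1 : R) \_ P) t.
  by apply: eq_Rintegral => y _; rewrite -hJ mul1r.
by rewrite -Rintegral_mkcondr (setIidr Pb) Rintegral_cst_itv ?mul1r// ltW.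
Qed.

End main_inequality.

(** * Vanishing of [h] *)

Section vanishing.
Variables (R : realType) (b M : R) (h : R -> R).
Let mu := @lebesgue_measure R.
Hypotheses (b0 : 0 < b) (M0 : 0 <= M) (ih : mu.-integrable `[0, b] (EFin \o h)).
Hypothesis hM : forall c d, 0 < c -> c < d -> d < b ->
  `|\int[mu]_(x in `]c, d[) h x| <= M * (d - c) * \int[mu]_(x in `]c, b]) `|h x|.

Lemma ae_norm_le_tail (a : R) : 0 <= a ->
  \forall x \ae mu, a < x < b -> `|h x| <= M * \int[mu]_(x in `]a, b]) `|h x|.
Proof.
move=> a0; set K := M * _.
have aeF : Filter (almost_everywhere mu) := ae_filter_ringOfSetsType mu.
pose g := h \_ `[0, b].
have ig (i : interval R) : mu.-integrable [set` i] (EFin \o g).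
  apply: (@integrableS _ _ _ (@lebesgue_measure R) setT) => //.
  by rewrite /g -restrict_EFin -integrable_mkcond.
have := @FTC1 R g (BLeft 0) (fun y => ig _) (integrable_locally (measurable_itv _) ih).
apply: filterS => x; set F := (fun x => _) => Fx /andP[ax xb].
have x0 : 0 < x by exact: le_lt_trans ax.
have [|dF] := Fx; first by rewrite /= lte_fin.
have gx : g x = h x by rewrite /g patchE mem_set//= in_itv/= !ltW.
rewrite gx derive1E => DF; apply/ler_addgt0Pr => e e0.
move: dF; rewrite /derivable => /cvg_ex[l Fl].
have lh : l = h x by rewrite -DF; apply/esym/cvg_lim.
move: Fl; rewrite lh => /cvgrPdist_le /(_ e e0).
rewrite /dnbhs/= near_withinE => /nbhs_ballP[r /= r0 Hr].
(* Small enough for the difference quotient to be within [e] of [h x], and for [x + t < b] as [hM]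
   requires. *)
pose t := Num.min (r / 2) ((b - x) / 2).
have t0 : 0 < t by rewrite lt_min !divr_gt0// subr_gt0.
have tr : t < r by rewrite gt_min ltr_pdivrMr// ltr_pMr// ltr1n.
have tb : x + t < b.
  have : t <= (b - x) / 2 by rewrite ge_min lexx orbT.
  lra.
have := Hr t; rewrite /ball/= sub0r normrN gtr0_norm// => /(_ tr (lt0r_neq0 t0)).
have -> : t%:A + x = x + t by rewrite addrC [X in _ + X]mulr1.
have Ft : F (x + t) - F x = \int[mu]_(y in `]x, x + t[) h y.
  rewrite /F Rintegral_itvB ?bnd_simp ?(ltW x0) ?lerDl ?(ltW t0)//.
  rewrite -Rintegral_itv_bndo_bndc//.
  apply: eq_Rintegral => y; rewrite inE/= in_itv/= => /andP[xy yt].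
  by rewrite /g patchE mem_set//= in_itv/= (ltW (lt_trans x0 xy)) (ltW (lt_trans yt tb)).
rewrite Ft => H.
(* The factor [d - c = t] in [hM] cancels [t^-1]; without it the averages would not be bounded as
   [t] tends to 0. *)
have K1 : `|t^-1 *: \int[mu]_(y in `]x, x + t[) h y| <= K.
  rewrite normrM normfV (gtr0_norm t0) mulrC ler_pdivrMr//.
  apply: (le_trans (hM x0 _ tb)); first by rewrite ltrDl.
  rewrite addrAC subrr add0r /K mulrAC ler_wpM2r ?(ltW t0)// ler_wpM2l//.
  have ihab : mu.-integrable `]a, b] (EFin \o (fun x => `|h x|)).
    apply: integrable_norm; apply: integrableS ih => //.
    by move=> y; rewrite /= !in_itv/= => /andP[ay ->]; rewrite (le_trans a0)// ltW.
  rewrite -subr_ge0 -(Rintegral_itvB ihab (x := x)) ?bnd_simp ?(ltW ax) ?(ltW xb)//.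
  rewrite subKr; apply: Rintegral_ge0 => //.
rewrite -[h x](subrK (t^-1 *: \int[mu]_(y in `]x, x + t[) h y)).
by rewrite addrC (le_trans (ler_normD _ _))// lerD.
Qed.

Lemma ae_zero_of_tail_bound : \forall x \ae mu, x \in `]0, b[ -> h x = 0.
Proof.
have aeF : Filter (almost_everywhere mu) := ae_filter_ringOfSetsType mu.
have ihn (i : interval R) : [set` i] `<=` `[0, b] ->
    mu.-integrable [set` i] (EFin \o (fun x => `|h x|)).
  by move=> ib; apply: integrable_norm; apply: integrableS ih.
(* Measuring the distance from [b] makes the upward real induction move leftwards. *)
pose T y := \int[mu]_(x in `]b - y, b]) `|h x|.
have sub u v : 0 <= u -> v <= b -> `]u, v] `<=` `[0, b].
  move=> u0 vb x; rewrite /= !in_itv/= => /andP[ux xv].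
  by rewrite (ltW (le_lt_trans u0 ux)) (le_trans xv vb).
have Tb : T b = 0.
  apply: (@real_induction _ 0 b (fun y => T y = 0)); first exact: ltW.
    by rewrite /T subr0 set_itv_ge ?bnd_simp ?ltxx// Rintegral_set0.
  move=> t /andP[t0 tb]; have M1 : 0 < M + 1 by rewrite ltr_wpDl.
  (* Then [v - u <= 1 / (2 (M + 1))], so [T v <= M * T v * (v - u) <= T v / 2], which forces
     [T v = 0]. *)
  exists (4 * (M + 1))^-1; first by rewrite invr_gt0 mulr_gt0.
  move=> u v u0 tu ut tv vt vb Tu.
  have uv : u <= v := le_trans ut tv.
  have bv : 0 <= b - v by rewrite subr_ge0.
  have ihv := ihn `]b - v, b] (sub _ _ bv (lexx _)).
  have T0 : 0 <= T v by apply: Rintegral_ge0.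
  have Tv : T v = \int[mu]_(x in `]b - v, b - u]) `|h x|.
    have := Rintegral_itvB ihv (x := b - u); rewrite -/(T v) -/(T u) Tu.
    rewrite !bnd_simp lerD2l lerN2 gerBl => /(_ uv u0) /eqP.
    by rewrite subr_eq0 => /eqP.
  have Tle : T v <= M * T v * (v - u).
    rewrite {1}Tv.
    have ihvu : mu.-integrable `]b - v, b - u] (EFin \o (fun x => `|h x|)).
      by apply: ihn; apply: sub => //; rewrite gerBl.
    have icst : mu.-integrable `]b - v, b - u] (EFin \o (cst (M * T v))).
      have icc : mu.-integrable `[b - v, b - u] (EFin \o (cst (M * T v))).
        by apply: integrable_continuous_itv; apply: continuous_subspaceT => y; exact: cst_continuous.
      by apply: integrableS icc => //; apply: subset_itvr; rewrite bnd_simp.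
    have -> : M * T v * (v - u) = \int[mu]_(x in `]b - v, b - u]) cst (M * T v) x.
      rewrite Rintegral_cst_itv ?lerD2l ?lerN2//.
      by congr (_ * _); ring.
    rewrite /Rintegral fine_le//.
    - exact: integrable_fin_num ihvu.
    - exact: integrable_fin_num icst.
    apply: ae_ge0_le_integral => //.
    - by case/integrableP : ihvu.
    - by move=> x _; rewrite lee_fin mulr_ge0.
    - by case/integrableP : icst.
    (* For [u = 0] the interval of integration contains [b], where [ae_norm_le_tail] says
       nothing. *)
    have zb : mu.-negligible [set b] by apply/negligibleP => //; exact: lebesgue_measure_set1.
    have H1 : \forall x \ae mu, x <> b.
      by apply: negligibleS zb => x /= H; apply: contrapT => xb; apply: H.
    apply: filterS2 H1 (ae_norm_le_tail bv) => x xb Hx.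
    rewrite /= in_itv/= => /andP[vx xu]; rewrite lee_fin; apply: Hx.
    rewrite vx/= lt_neqAle; apply/andP; split; first exact/eqP.
    by apply: (le_trans xu); rewrite gerBl.
  have uv2 : v - u <= (2 * (M + 1))^-1.
    have -> : (2 * (M + 1))^-1 = (4 * (M + 1))^-1 + (4 * (M + 1))^-1.
      by field; rewrite gt_eqF.
    move: (_^-1) tu vt => w tu vt; lra.
  have half : M * T v * (v - u) <= T v / 2.
    apply: (@le_trans _ _ ((M + 1) * T v * (2 * (M + 1))^-1)).
      rewrite ler_pM// ?mulr_ge0 ?subr_ge0//.
      by rewrite ler_wpM2r// lerDl.
    rewrite le_eqVlt; apply/orP; left; apply/eqP; field.
    by rewrite gt_eqF.
  by apply: le_anti; rewrite T0 andbT; lra.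
have sub0 : `]b - b, b] `<=` `[0, b] by apply: sub; rewrite ?subrr.
have ihbb : mu.-integrable `]b - b, b] (EFin \o h) by apply: integrableS ih.
have mh : measurable_fun `]b - b, b] (EFin \o h) by case/integrableP : ihbb.
have : ae_eq mu (`]b - b, b]%classic : set R) (EFin \o h) (cst 0%E).
  apply/ae_eq_integral_abs => //.
  have I0 := ihn `]b - b, b] sub0.
  move: Tb; rewrite /T /Rintegral => E.
  by rewrite -[LHS]fineK ?E//; exact: integrable_fin_num I0.
apply: filterS => x H xb; have := H; rewrite /= subrr.
rewrite in_itv/=; move: xb; rewrite in_itv/= => /andP[-> /ltW ->] /(_ isT).
by case.
Qed.

End vanishing.

Theorem theorem2p2p1 (R : realType) (q1 q2 : R -> R)
    (hq1 : L11 q1) (hq2 : L11 q2) :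
  property_Cphi q1 q2.
Proof.
rewrite /property_Cphi => phi1 phi2 r1 r2 b b0 h ih h0.
set mu := @lebesgue_measure R.
(* Extension by zero passes from the open interval of the statement to the closed one used by the
   lemmas, with the same integrals. *)
pose g := h \_ `]0, b[.
have ig : mu.-integrable `[0, b] (EFin \o g).
  apply: (@integrableS _ _ _ (@lebesgue_measure R) setT) => //.
  by rewrite /g -restrict_EFin -integrable_mkcond.
have [M M0 HM] := product_bound hq1 hq2 b0.
have g0 k : 0 < k -> \int[mu]_(x in `[0, b]) (g x * (phi1 x k * phi2 x k)) = 0.
  move=> k0; rewrite -[RHS](h0 k k0).
  have igp : mu.-integrable `[0, b] (EFin \o (fun x => g x * (phi1 x k * phi2 x k))).
    apply: integrable_mul_continuous => //; first exact: ltW.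
    move=> x; apply: cvgM.
      exact: (regular_solution_continuous (r1 _ k0)).
    exact: (regular_solution_continuous (r2 _ k0)).
  have i1 : mu.-integrable `]0, b] (EFin \o (fun x => g x * (phi1 x k * phi2 x k))).
    by apply: integrableS igp => //; apply: subset_itvr; rewrite bnd_simp.
  have i2 : mu.-integrable `]0, b[ (EFin \o (fun x => g x * (phi1 x k * phi2 x k))).
    by apply: integrableS igp => //; exact: subset_itv_oo_cc.
  rewrite -(Rintegral_itv_obnd_cbnd i1) -(Rintegral_itv_bndo_bndc i2).
  by apply: eq_Rintegral => x xb; rewrite /g patchE xb mulrA.
have gb c d : 0 < c -> c < d -> d < b ->
    `|\int[mu]_(x in `]c, d[) g x| <= M * (d - c) * \int[mu]_(x in `]c, b]) `|g x|.
  exact: (interval_test_inequality b0 M0 HM r1 r2 ig g0).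
have aeF : Filter (almost_everywhere mu) := ae_filter_ringOfSetsType mu.
have := ae_zero_of_tail_bound b0 M0 ig gb; apply: filterS => x H xb.
by have := H xb; rewrite /g patchE mem_set.
Qed.
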